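(* Let $C_0,D,E$, $\alpha_0,\beta_0,\delta$, $Q_1,Q_2$ and the continuous functions $r,\varphi$ be as in the context. Denote by $\varphi_1(\tau,\lambda)\le\dots\le\varphi_n(\tau,\lambda)$ the eigenvalues of $\varphi(\tau,\lambda)$. Then, for every $\tau\in\,]0,t]$: $$\lim_{\lambda\to+\infty}\varphi(\tau,\lambda)=-\infty\quad\text{(i.e. } \varphi_j(\tau,\lambda)\to-\infty \text{ for every } j),\qquad \lim_{\lambda\to-\infty}\tan\varphi(\tau,\lambda)=0,$$ and $\varphi(\tau,\lambda)$ is a strictly decreasing function of $\lambda$ (i.e. each $\varphi_j(\tau,\lambda)$ is strictly decreasing in $\lambda\in\mathbb{R}$). Moreover, the eigenvalues of $\varphi(\tau,\lambda)$ converge, as $\lambda\to-\infty$, to constant functions of $\tau$ on $]0,t]$ (i.e. for each $j$ there is a constant $c_j\in\mathbb{R}$ with $\lim_{\lambda\to-\infty}\varphi_j(\tau,\lambda)=c_j$ for every $\tau\in\,]0,t]$).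
   Context: All matrices are real $n\times n$, $M^{*}$ is the transpose of $M$, and inequalities such as $C_0>0$ mean positive definiteness. Let $t>0$ and let $C_0,D,E$ be continuous symmetric-matrix-valued functions of $\tau\in[0,t]$, independent of $\lambda$, with $C_0(\tau)>0$ and $E(\tau)>0$. For $\lambda\in\mathbb{R}$ consider the linear Hamiltonian system $$\dot q=C_0p,\qquad \dot p=-(-D+\lambda E)q ,$$ equivalent to the Sturm–Liouville equation $(C_0^{-1}\dot q)^{\cdot}+(-D+\lambda E)q=0$. Let $(Q_c,P_c)$ and $(Q_s,P_s)$ be its matrix solutions (depending on $\tau$ and $\lambda$) with $Q_c(0)=P_s(0)=I_n$, $Q_s(0)=P_c(0)=0$. Let $\alpha_0,\beta_0,\delta$ be constant matrices (independent of $\tau$ and $\lambda$) with $\alpha_0\beta_0^{*}=\beta_0\alpha_0^{*}$, $\alpha_0\alpha_0^{*}+\beta_0\beta_0^{*}=I_n$, $\delta=\delta^{*}$ (they encode the boundary conditions $\beta_0q(0)+\alpha_0p(0)=0$, $\delta q(t)+p(t)=0$). Define $$Q_2=(\alpha_0Q_c^{*}-\beta_0Q_s^{*})\delta+\alpha_0P_c^{*}-\beta_0P_s^{*},\qquad Q_1=-\alpha_0Q_c^{*}+\beta_0Q_s^{*}.$$ The functions $r(\tau,\lambda)$, $\varphi(\tau,\lambda)$ are continuous matrix-valued functions of $(\tau,\lambda)\in[0,t]\times\mathbb{R}$ with $\det r\ne0$, $\varphi$ symmetric, and $$Q_1=r\sin\varphi,\qquad Q_2=r\cos\varphi .$$ Functions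 of symmetric matrices are defined by the functional calculus; $\tan\varphi$ is defined where $\cos\varphi$ is invertible, and there $\tan\varphi=Q_2^{-1}Q_1$. (The limit of $\tan\varphi$ includes the assertion that it is defined for all sufficiently negative $\lambda$.) *)

(* Defs.v *)
From HB Require Import structures.
From mathcomp Require Import all_boot all_order all_algebra.
From mathcomp Require Import all_classical all_reals all_analysis.

Set Implicit Arguments.
Unset Strict Implicit.
Unset Printing Implicit Defensive.

Import Order.TTheory GRing.Theory Num.Theory.
Import numFieldNormedType.Exports.

Local Open Scope classical_set_scope.
Local Open Scope ring_scope.

Definition posdefmx (R : realType) (n : nat) (A : 'M[R]_n) : Prop :=
  A^T = A /\ forall v : 'rV[R]_n, v != 0 -> 0 < (v *m A *m v^T) ord0 ord0.

(* Derivative relative to A: one-sided at the end points when A is an interval. *)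
Definition is_derive_within (R : realType) (n : nat) (A : set R)
    (F : R -> 'M[R]_n) (x : R) (dF : 'M[R]_n) : Prop :=
  (fun s : R => (s - x)^-1 *: (F s - F x)) @ within A (dnbhs x) --> dF.

Definition hamiltonian_solution (R : realType) (n : nat) (t : R)
    (C0 D E : R -> 'M[R]_n) (lam : R) (Q P : R -> 'M[R]_n) : Prop :=
  forall tau : R, 0 <= tau <= t ->
    is_derive_within `[0, t] Q tau (C0 tau *m P tau) /\
    is_derive_within `[0, t] P tau (- ((- D tau + lam *: E tau) *m Q tau)).

Definition bdQ1 (R : realType) (n : nat) (alpha0 beta0 : 'M[R]_n)
    (Qc Qs : 'M[R]_n) : 'M[R]_n :=
  - (alpha0 *m Qc^T) + beta0 *m Qs^T.

Definition bdQ2 (R : realType) (n : nat) (alpha0 beta0 delta : 'M[R]_n)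
    (Qc Pc Qs Ps : 'M[R]_n) : 'M[R]_n :=
  (alpha0 *m Qc^T - beta0 *m Qs^T) *m delta + alpha0 *m Pc^T - beta0 *m Ps^T.

Definition is_symfun (R : realType) (n : nat) (f : R -> R)
    (A B : 'M[R]_n) : Prop :=
  exists (P : 'M[R]_n) (d : 'rV[R]_n),
    [/\ P *m P^T = 1%:M,
        A = P *m diag_mx d *m P^T &
        B = P *m diag_mx (map_mx f d) *m P^T].

(* Functional calculus, for symmetric A only: the value is 0 when A is not
   orthogonally diagonalizable.  It does not depend on the diagonalization
   chosen, by [is_symfun_uniq]. *)
Definition symfun (R : realType) (n : nat) (f : R -> R) (A : 'M[R]_n) :
    'M[R]_n :=
  xget 0 [set B | is_symfun f A B].

Lemma is_symfun_uniq (R : realType) (n : nat) (f : R -> R) (A B C : 'M[R]_n) :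
  is_symfun f A B -> is_symfun f A C -> B = C.
Proof.
move=> [P [d [PP -> ->]]] [Q [e [QQ eA ->]]].
have PP' := mulmx1C PP; have QQ' := mulmx1C QQ.
have [U defU] : exists U, U = P^T *m Q by exists (P^T *m Q).
have dU : diag_mx d *m U = U *m diag_mx e.
  have : P^T *m (P *m diag_mx d *m P^T) *m Q = P^T *m (Q *m diag_mx e *m Q^T) *m Q.
    by rewrite eA.
  by rewrite !mulmxA PP' mul1mx -!mulmxA QQ' mulmx1 defU !mulmxA.
have fU : diag_mx (map_mx f d) *m U = U *m diag_mx (map_mx f e).
  apply/matrixP => i j; move/matrixP/(_ i j): dU.
  rewrite !mul_diag_mx !mul_mx_diag !mxE mulrC.
  have [->|U0] := eqVneq (U i j) 0; first by rewrite mulr0 !mul0r.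
  by move=> /(mulfI U0) ->; rewrite mulrC.
have QE : Q = P *m U by rewrite defU mulmxA PP mul1mx.
have UU : U *m U^T = 1%:M.
  by rewrite defU trmx_mul trmxK mulmxA -(mulmxA P^T) QQ mulmx1 PP'.
by rewrite QE -(mulmxA P U) -fU trmx_mul !mulmxA -(mulmxA _ U) UU mulmx1.
Qed.

Lemma is_symfunE (R : realType) (n : nat) (f : R -> R) (A B : 'M[R]_n) :
  is_symfun f A B -> symfun f A = B.
Proof.
by move=> fAB; apply: xget_subset1 => // C C' fC fC'; apply: is_symfun_uniq fC fC'.
Qed.

Definition ordered_eigenvalues (R : realType) (n : nat) (A : 'M[R]_n)
    (e : 'I_n -> R) : Prop :=
  {homo e : i j / (i <= j)%N >-> i <= j} /\
  char_poly A = \prod_(i < n) ('X - (e i)%:P).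

(* Main.v *)
Require Import Defs.
From mathcomp Require Import all_boot all_order all_algebra all_fingroup.
From mathcomp Require Import all_classical all_reals all_analysis.
From mathcomp Require Import ring lra.

Set Implicit Arguments.
Unset Strict Implicit.
Unset Printing Implicit Defensive.

Import Order.TTheory GRing.Theory Num.Theory.
Import numFieldNormedType.Exports.

Local Open Scope classical_set_scope.
Local Open Scope ring_scope.

(** Write U and V for the transposes of q and p, where (q, p) is the matrix
    solution with q = alpha0^T and p = - beta0^T at 0.  Then Q1 = - U and
    Q2 = U delta + V, and the Wronskian W(l0, l1) = U0 V1^T - V0 U1^T of the
    solutions for the parameters l0 and l1 satisfies
    W' = - (l1 - l0) U0 E U1^T and W = 0 at 0.

    Everything rests on one identity.  If y r is an eigenvector of phi for the
    eigenvalue a, then y U = - sin a (y r) and y (U delta + V) = cos a (y r).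
    Hence, for two points of the (tau, lambda) plane, with such vectors y0, y1
    and eigenvalues a0, a1,
      y0 (U0 V1^T - V0 U1^T) y1^T = sin (a1 - a0) <y0 r0, y1 r1>
    [eigenangle_wronskian].  When the second point tends to the first one,
    compactness of the unit sphere lets y1 converge to such a vector y0, the
    scalar product becomes positive, and the sign of the Wronskian is the
    direction in which the eigenvalue moves [near_eigenangle].  The eigenvalues
    are continuous by Weyl's inequality, so a one-sided local decrease at every
    point gives monotonicity [right_local_noninc].

    In the direction of lambda, the Wronskian at tau is - (l1 - l0) times the
    integral of U0 E U1^T over [0, tau], which is negative definite in the
    limit because no nonzero combination of the solutions vanishes identically
    [ev_decreasing].

    In the direction of tau, the Wronskian is, to first order, minus
    C[p] + (-D + lambda E)[q], so an eigenvalue a decreases at a rate at least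
    c (cos^2 a + sg^2 sin^2 a), where sg can be taken as large as desired once
    lambda is large.  In the modified angle [prufer], the continuous branch of
    arctan (sg tan a), this rate is at least the constant c sg, and the two
    angles differ by less than pi / 2.  So over [0, tau] the eigenvalue drops
    by an amount that tends to infinity with lambda, starting from a value at
    tau = 0 that does not grow with lambda [ev_cvg_ninfty].

    For lambda -> -oo, the function kappa |q|^2 - <q, p> is nonincreasing in
    tau for every fixed affine kappa, as soon as -lambda is large: this is the
    Riccati inequality for p q^{-1}, in a form which does not require q to be
    invertible.  It gives <q, p> >= k |q|^2 on [tau0, t] with k arbitrarily
    large [riccati_lower], that is k |sin a| <= |cos a| for every eigenvalue a
    [sin_small].  So cos phi is invertible, tan phi tends to 0, and each
    eigenvalue stays, for all tau in [tau0, t] and all very negative lambda,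
    within pi / 2 of one zero of the sine, to which it must converge: this zero
    is the same for all tau by connectedness [ev_cvg_const]. *)

(** * Scalar product of row vectors and entrywise limits *)

Definition dot (R : realType) (n : nat) (x y : 'rV[R]_n) : R :=
  (x *m y^T) ord0 ord0.

Section Dot.
Variables (R : realType) (n : nat).
Implicit Types (x y z : 'rV[R]_n) (A : 'M[R]_n).

Lemma dotE x y : dot x y = \sum_i x ord0 i * y ord0 i.
Proof. by rewrite /dot mxE; apply: eq_bigr => i _; rewrite mxE. Qed.

Lemma dotC x y : dot x y = dot y x.
Proof. by rewrite !dotE; apply: eq_bigr => i _; rewrite mulrC. Qed.

Lemma dotDl x y z : dot (x + y) z = dot x z + dot y z.
Proof. by rewrite /dot mulmxDl mxE. Qed.

Lemma dotNl x z : dot (- x) z = - dot x z.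
Proof. by rewrite /dot mulNmx mxE. Qed.

Lemma dotZl a x z : dot (a *: x) z = a * dot x z.
Proof. by rewrite /dot -scalemxAl mxE. Qed.

Lemma dotBl x y z : dot (x - y) z = dot x z - dot y z.
Proof. by rewrite dotDl dotNl. Qed.

Lemma dotDr x y z : dot x (y + z) = dot x y + dot x z.
Proof. by rewrite !(dotC x) dotDl. Qed.

Lemma dotNr x z : dot x (- z) = - dot x z.
Proof. by rewrite !(dotC x) dotNl. Qed.

Lemma dotZr a x z : dot x (a *: z) = a * dot x z.
Proof. by rewrite !(dotC x) dotZl. Qed.

Lemma dotBr x y z : dot x (y - z) = dot x y - dot x z.
Proof. by rewrite dotDr dotNr. Qed.

Lemma dot0l x : dot 0 x = 0.
Proof. by rewrite /dot mul0mx mxE. Qed.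

Lemma dot_mull x y A : dot (x *m A) y = dot x (y *m A^T).
Proof. by rewrite /dot trmx_mul trmxK mulmxA. Qed.

Lemma dot_ge0 x : 0 <= dot x x.
Proof. by rewrite dotE sumr_ge0// => i _; rewrite -expr2 sqr_ge0. Qed.

Lemma dot_eq0 x : (dot x x == 0) = (x == 0).
Proof.
apply/eqP/eqP => [|->]; last by rewrite dot0l.
rewrite dotE => /psumr_eq0P H; apply/rowP => i; rewrite mxE.
by apply/eqP; rewrite -sqrf_eq0 expr2 H// => j _; rewrite -expr2 sqr_ge0.
Qed.

Lemma dot_gt0 x : (0 < dot x x) = (x != 0).
Proof. by rewrite lt_def dot_eq0 dot_ge0 andbT. Qed.

Lemma sqr_coord_le_dot x i : x ord0 i ^+ 2 <= dot x x.
Proof.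
rewrite dotE (bigD1 i)//= expr2 lerDl sumr_ge0// => j _.
by rewrite -expr2 sqr_ge0.
Qed.

(** The norm of A is the largest absolute value of its entries, so bounding
    each x_i x_j by the mean of the squares costs the factor n. *)
Lemma dot_mul_le_norm x A : `|dot (x *m A) x| <= `|A| * n%:R * dot x x.
Proof.
have Aij i j : `|A i j| <= `|A|.
  by rewrite [leRHS]/Num.norm/= mx_normrE; exact: (le_bigmax _ _ (i, j)).
have h i j : `|x ord0 i * A i j * x ord0 j| <=
    `|A| * ((x ord0 i ^+ 2 + x ord0 j ^+ 2) / 2).
  rewrite !normrM -mulrA mulrCA ler_pM// ?mulr_ge0//.
  rewrite -(real_normK (num_real (x ord0 i))) -(real_normK (num_real (x ord0 j))).
  have := sqr_ge0 (`|x ord0 i| - `|x ord0 j|); nra.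
rewrite dotE; apply: le_trans (ler_norm_sum _ _ _) _.
apply: (@le_trans _ _ (\sum_j \sum_i `|A| *
   ((x ord0 i ^+ 2 + x ord0 j ^+ 2) / 2))).
  apply: ler_sum => j _; rewrite mxE mulr_suml.
  by apply: le_trans (ler_norm_sum _ _ _) _; apply: ler_sum => i _; exact: h.
have -> : dot x x = \sum_i x ord0 i ^+ 2.
  by rewrite dotE; apply: eq_bigr => i _; rewrite expr2.
under eq_bigr => j _ do rewrite -mulr_sumr -mulr_suml big_split/= sumr_const card_ord.
rewrite -mulr_sumr -mulr_suml big_split/= sumr_const card_ord sumrMnl.
rewrite -[X in X + _]mulr_natr -[X in _ + X]mulr_natr.
set S := \sum_i _; set N : R := `|A|; set k : R := n%:R.
by rewrite le_eqVlt; apply/orP; left; apply/eqP; field.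
Qed.

End Dot.

Section MatrixLimits.
Context {T : Type} (F : set_system T) {FF : Filter F} {R : realType}.

Lemma cvg_mxP m n (A : T -> 'M[R]_(m, n)) (B : 'M[R]_(m, n)) :
  A @ F --> B <-> forall i j, A s i j @[s --> F] --> B i j.
Proof.
split=> [AB i j|AB].
  exact: (cvg_comp _ _ AB (@coord_continuous _ _ _ i j B)).
apply/cvg_ballP => e e0.
have H : \forall s \near F, forall ij : 'I_m * 'I_n,
    ball (B ij.1 ij.2) e (A s ij.1 ij.2).
  by apply: filter_forall => -[i j]; exact: (cvg_ball (AB i j)).
by apply: filterS H => s H; split=> // i j; exact: (H (i, j)).
Qed.

Lemma cvg_mulmx m n p (A : T -> 'M[R]_(m, n)) (B : T -> 'M[R]_(n, p))
    (A0 : 'M[R]_(m, n)) (B0 : 'M[R]_(n, p)) :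
  A @ F --> A0 -> B @ F --> B0 -> A s *m B s @[s --> F] --> A0 *m B0.
Proof.
move=> /cvg_mxP hA /cvg_mxP hB; apply/cvg_mxP => i j; rewrite mxE.
under eq_fun do rewrite mxE.
apply: cvg_big => [|k _]; first exact: add_continuous.
by apply: cvgM; [exact: hA|exact: hB].
Qed.

Lemma cvg_trmx m n (A : T -> 'M[R]_(m, n)) (A0 : 'M[R]_(m, n)) :
  A @ F --> A0 -> (A s)^T @[s --> F] --> A0^T.
Proof.
move=> /cvg_mxP hA; apply/cvg_mxP => i j; rewrite mxE.
by under eq_fun do rewrite mxE; exact: hA.
Qed.

Lemma cvg_dot n (x y : T -> 'rV[R]_n) (x0 y0 : 'rV[R]_n) :
  x @ F --> x0 -> y @ F --> y0 -> dot (x s) (y s) @[s --> F] --> dot x0 y0.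
Proof.
by move=> hx hy; move/cvg_mxP: (cvg_mulmx hx (cvg_trmx hy)); exact.
Qed.

End MatrixLimits.

Lemma unit_sphere_compact (R : realType) n :
  compact [set x : 'rV[R]_n | dot x x = 1].
Proof.
apply: bounded_closed_compact.
  exists 1; split; first exact: num_real.
  move=> M M1 x /= x1; apply: le_trans (ltW M1).
  rewrite /Num.norm/= mx_normrE; apply/bigmax_leP; split=> // -[i j] _ /=.
  rewrite (ord1 i) -(@ler_pXn2r _ 2)// ?nnegrE// expr1n real_normK ?num_real//.
  by rewrite -x1 sqr_coord_le_dot.
apply: (@closed_comp _ _ (fun x : 'rV[R]_n => dot x x) [set 1]).
  by move=> x _; exact (@cvg_dot _ (nbhs x) _ R n id id x x cvg_id cvg_id).
exact: closed_eq.
Qed.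

(** Compactness in the form used throughout: a property of s that involves an
    auxiliary unit vector y s may be checked along finer filters G on which
    y converges.  If P failed frequently, an ultrafilter containing the failure
    set would be such a G. *)
Lemma near_unit_sphere (R : realType) n (T : Type) (F : set_system T)
    (y : T -> 'rV[R]_n) (P : T -> Prop) :
  ProperFilter F -> (\forall s \near F, dot (y s) (y s) = 1) ->
  (forall (G : set_system T) (y0 : 'rV[R]_n), ProperFilter G -> F `<=` G ->
     dot y0 y0 = 1 -> y @ G --> y0 -> \forall s \near G, P s) ->
  \forall s \near F, P s.
Proof.
move=> PF y1 H; apply: contrapT => nP.
pose F' := within (~` P) F.
have PF' : ProperFilter F'.
  split; last exact: within_filter.
  move=> F0; apply: nP; move: F0; rewrite /F' /within/=.
  by apply: filterS => s; exact: contra_notP.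
have [G [UG sG]] := ultraFilterLemma PF'.
have FG : F `<=` G by move=> A FA; apply: sG; rewrite /F' /within/=; apply: filterS FA => s + _.
have [y0 [/= y01 y0G]] : [set x : 'rV[R]_n | dot x x = 1] `&` cluster (y @ G) !=set0.
  by apply: unit_sphere_compact; exact: FG.
have yG : y @ G --> y0.
  move=> V Vy0; have [//|] := in_ultra_setVsetC (y @^-1` V) UG.
  move=> GV; have [z [Vz]] := y0G (~` V) V GV Vy0.
  by [].
have GP : G P := H G y0 (@ultra_proper _ _ UG) FG y01 yG.
have GnP : G (~` P) by apply: sG; exact: withinT.
by have [s []] := filter_ex (filterI GP GnP).
Qed.

(** * One-sided monotonicity and derivatives relative to a set *)

(** The supremum z of the points where f is at most f a satisfies f z <= f a by
    continuity, and if z < b, the hypothesis at z contradicts maximality. *)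
Lemma right_local_noninc (R : realType) (f : R -> R) (a b : R) :
  a <= b -> {within `[a, b], continuous f} ->
  (forall x, a <= x < b -> \forall s \near x^'+, f s <= f x) -> f b <= f a.
Proof.
move=> ab cf loc; rewrite leNgt; apply/negP => fab.
pose S := [set x | a <= x <= b /\ f x <= f a].
have Sa : S a by split; rewrite ?lexx.
have supS : has_sup S.
  by split; [exists a|exists b => x [/andP[]]].
set z : R := sup S.
have az : a <= z := sup_upper_bound supS Sa.
have zb : z <= b by apply: sup_le_ub; [exists a|move=> x [/andP[]]].
have fz : f z <= f a.
  have /subspace_continuousP/(_ z) := cf; rewrite /= in_itv/= az zb => /(_ isT) cz.
  rewrite leNgt; apply/negP => faz.
  have : nbhs z [set s : R | a <= s <= b -> f a < f s].
    have : \forall s \near within `[a, b] (nbhs z), f a < f s.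
      exact: (cvgr_gt _ cz _ faz).
    by rewrite near_withinE; apply: filterS => s /=; rewrite in_itv.
  move=> /nbhs_ballP[e /= e0 he].
  have [x [xab fx] zex] := sup_adherent e0 supS.
  have xz : x <= z by apply: (sup_upper_bound supS).
  suff : f a < f x by rewrite ltNge fx.
  apply: he => //; rewrite /ball/= ger0_norm ?subr_ge0//.
  by rewrite ltrBlDr -ltrBlDl.
have zltb : z < b.
  by rewrite lt_neqAle zb andbT; apply/eqP => zE; move: fab; rewrite ltNge -zE fz.
have zz : \forall s \near z^'+, [/\ f s <= f z, z < s & s <= b].
  have h1 : \forall s \near z^'+, f s <= f z by apply: loc; rewrite az zltb.
  near=> s; split.
  - by near: s; exact: h1.
  - by near: s; exact: nbhs_right_gt.
  - by near: s; exact: nbhs_right_le.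
have [s /= [fs zs sb]] := @filter_ex _ (z^'+) _ _ zz.
suff : s <= z by rewrite leNgt zs.
apply: (sup_upper_bound supS); split; last exact: le_trans fs fz.
by rewrite (le_trans az (ltW zs)) sb.
Unshelve. all: by end_near. Qed.

Definition is_sderive_within (R : realType) (A : set R) (f : R -> R)
    (x d : R) : Prop :=
  (s - x)^-1 * (f s - f x) @[s --> within A (dnbhs x)] --> d.

Lemma near_right_itv (R : realType) (t x : R) (P : R -> Prop) :
  0 <= x < t -> (\forall s \near within `[0, t] (dnbhs x), P s) ->
  \forall s \near x^'+, P s.
Proof.
move=> /andP[x0 xt] H.
have {}H : nbhs x [set s : R | s != x -> s \in `[0, t] -> P s] := H.
near=> s.
have xs : x < s by near: s; exact: nbhs_right_gt.
have st : s <= t by near: s; exact: nbhs_right_le.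
have : s != x -> s \in `[0, t] -> P s.
  near: s; apply: (@cvg_within _ (nbhs x)); exact: H.
by apply; [rewrite gt_eqF|rewrite /= in_itv/= st andbT ltW// (le_lt_trans x0)].
Unshelve. all: by end_near. Qed.

Lemma cvg_within_dnbhs (R : realType) (A : set R) (x : R) :
  (s : R) @[s --> within A (dnbhs x)] --> x.
Proof.
move=> U Ux; have : nbhs x [set s : R | s != x -> A s -> U s].
  by apply: filterS Ux => s Us _ _.
exact.
Qed.

Lemma cvg_dnbhs_within (R : realType) (V : topologicalType) (A : set R)
    (f : R -> V) (x : R) :
  f @ within A (dnbhs x) --> f x -> f @ within A (nbhs x) --> f x.
Proof.
move=> H U Ux; have := H U Ux.
rewrite /= /nbhs /= /within /= => -[e /= e0 He].
exists e => //= s /He; have [->|sx] := eqVneq s x; last by apply.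
by move=> _ _; exact: nbhs_singleton.
Qed.

Section DeriveWithin.
Variables (R : realType) (n : nat) (A : set R).
Implicit Types (F G : R -> 'M[R]_n) (x : R).

Lemma derive_within_cvg F x dF :
  is_derive_within A F x dF -> F @ within A (dnbhs x) --> F x.
Proof.
move=> dFx.
have h : (s - x) *: ((s - x)^-1 *: (F s - F x)) + F x
    @[s --> within A (dnbhs x)] --> (x - x) *: dF + F x.
  apply: cvgD; last exact: cvg_cst.
  apply: cvgZ; last exact: dFx.
  apply: cvgB; last exact: cvg_cst.
  exact: cvg_within_dnbhs.
rewrite subrr scale0r add0r in h.
apply: cvg_trans h; apply: near_eq_cvg.
rewrite near_withinE near_withinE; near=> s => sx _.
by rewrite scalerA divff ?subr_eq0// scale1r subrK.
Unshelve. all: by end_near. Qed.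

Lemma derive_within_continuous F x dF :
  is_derive_within A F x dF -> F @ within A (nbhs x) --> F x.
Proof. by move=> /derive_within_cvg; exact: cvg_dnbhs_within. Qed.

Lemma derive_within_mulmx F G x dF dG :
  is_derive_within A F x dF -> is_derive_within A G x dG ->
  is_derive_within A (fun s => F s *m G s) x (dF *m G x + F x *m dG).
Proof.
move=> hF hG; have cG := derive_within_cvg hG.
rewrite /is_derive_within.
have -> : (fun s => (s - x)^-1 *: (F s *m G s - F x *m G x)) =
    (fun s => ((s - x)^-1 *: (F s - F x)) *m G s
       + F x *m ((s - x)^-1 *: (G s - G x))).
  apply/funext => s; rewrite -scalemxAl -scalemxAr -scalerDr mulmxBl mulmxBr.
  by rewrite addrA subrK.
apply: cvgD; apply: cvg_mulmx => //; exact: cvg_cst.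
Qed.

Lemma derive_within_trmx F x dF :
  is_derive_within A F x dF -> is_derive_within A (fun s => (F s)^T) x dF^T.
Proof.
move=> /cvg_trmx; apply: cvg_trans; apply: near_eq_cvg.
by near=> s; rewrite /= linearZ/= linearB.
Unshelve. all: by end_near. Qed.

Lemma derive_withinD F G x dF dG :
  is_derive_within A F x dF -> is_derive_within A G x dG ->
  is_derive_within A (fun s => F s + G s) x (dF + dG).
Proof.
move=> hF hG; rewrite /is_derive_within.
under eq_fun do rewrite opprD addrACA scalerDr.
exact: cvgD.
Qed.

Lemma derive_withinN F x dF :
  is_derive_within A F x dF -> is_derive_within A (fun s => - F s) x (- dF).
Proof.
move=> hF; rewrite /is_derive_within.
under eq_fun do rewrite -opprD scalerN.
exact: cvgN.
Qed.

Lemma derive_withinB F G x dF dG :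
  is_derive_within A F x dF -> is_derive_within A G x dG ->
  is_derive_within A (fun s => F s - G s) x (dF - dG).
Proof. by move=> hF hG; apply: derive_withinD => //; exact: derive_withinN. Qed.

Lemma derive_within_cst (B : 'M[R]_n) x : is_derive_within A (fun=> B) x 0.
Proof.
rewrite /is_derive_within; under eq_fun do rewrite subrr scaler0.
exact: cvg_cst.
Qed.

Lemma derive_within_mulmxl (B : 'M[R]_n) F x dF :
  is_derive_within A F x dF -> is_derive_within A (fun s => B *m F s) x (B *m dF).
Proof.
move=> hF; have := derive_within_mulmx (derive_within_cst B x) hF.
by rewrite mul0mx add0r.
Qed.

Lemma sderive_within_dot F x dF (y z : 'rV[R]_n) :
  is_derive_within A F x dF ->
  is_sderive_within A (fun s => dot (y *m F s) z) x (dot (y *m dF) z).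
Proof.
move=> hF; rewrite /is_sderive_within.
under eq_fun do rewrite -dotBl -mulmxBr -dotZl scalemxAr.
by apply: cvg_dot; last exact: cvg_cst; apply: cvg_mulmx; [exact: cvg_cst|].
Qed.

End DeriveWithin.

Section ScalarDerive.
Variables (R : realType) (A : set R).
Implicit Types (f g : R -> R) (x : R).

Lemma sderive_within_cvg f x d :
  is_sderive_within A f x d -> f @ within A (dnbhs x) --> f x.
Proof.
move=> dfx.
have h : (s - x) * ((s - x)^-1 * (f s - f x)) + f x
    @[s --> within A (dnbhs x)] --> (x - x) * d + f x.
  apply: cvgD; last exact: cvg_cst.
  apply: cvgM; last exact: dfx.
  apply: cvgB; last exact: cvg_cst.
  exact: cvg_within_dnbhs.
rewrite subrr mul0r add0r in h.
apply: cvg_trans h; apply: near_eq_cvg.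
rewrite near_withinE near_withinE; near=> s => sx _.
by rewrite mulrA divff ?subr_eq0// mul1r subrK.
Unshelve. all: by end_near. Qed.

Lemma sderive_withinM f g x df dg :
  is_sderive_within A f x df -> is_sderive_within A g x dg ->
  is_sderive_within A (fun s => f s * g s) x (df * g x + f x * dg).
Proof.
move=> hf hg; have cg := sderive_within_cvg hg.
rewrite /is_sderive_within.
have -> : (fun s => (s - x)^-1 * (f s * g s - f x * g x)) =
    (fun s => ((s - x)^-1 * (f s - f x)) * g s
       + f x * ((s - x)^-1 * (g s - g x))).
  by apply/funext => s; ring.
apply: cvgD; apply: cvgM => //; exact: cvg_cst.
Qed.

Lemma sderive_withinB f g x df dg :
  is_sderive_within A f x df -> is_sderive_within A g x dg ->
  is_sderive_within A (fun s => f s - g s) x (df - dg).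
Proof.
move=> hf hg; rewrite /is_sderive_within.
have -> : (fun s => (s - x)^-1 * (f s - g s - (f x - g x))) =
    (fun s => (s - x)^-1 * (f s - f x) - (s - x)^-1 * (g s - g x)).
  by apply/funext => s; ring.
exact: cvgB.
Qed.

Lemma sderive_within_affine (a b x : R) :
  is_sderive_within A (fun s => a + b * s) x b.
Proof.
apply: (@cvg_trans _ (b @[s --> within A (dnbhs x)])); last exact: cvg_cst.
apply: near_eq_cvg.
rewrite near_withinE near_withinE; near=> s => sx _.
by rewrite [RHS]/= opprD addrACA subrr add0r -mulrBr mulrCA mulVf ?mulr1// subr_eq0.
Unshelve. all: by end_near. Qed.

End ScalarDerive.

(** Tilting f by a small slope e' makes the derivative strictly negative, hence
    gives the local decrease to the right of each point. *)
Lemma sderive_within_noninc (R : realType) (t a b : R) (f df : R -> R) :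
  0 <= a -> a <= b -> b <= t ->
  (forall x, a <= x <= b -> is_sderive_within `[0, t] f x (df x)) ->
  (forall x, a <= x <= b -> df x <= 0) -> f b <= f a.
Proof.
move=> a0 ab bt dfx df0.
apply/ler_addgt0Pr => e e0.
pose e' := e / (b - a + 1).
have e'0 : 0 < e' by rewrite divr_gt0//; lra.
suff H : f b - e' * b <= f a - e' * a.
  have : e' * (b - a) <= e.
    by rewrite /e' mulrAC ler_pdivrMr ?ler_wpM2l//; lra.
  by lra.
apply: (@right_local_noninc _ (fun s => f s - e' * s)) => //.
  apply/subspace_continuousP => x; rewrite /= in_itv/= => xab.
  apply: cvgB; last first.
    apply: cvgM; first exact: cvg_cst.
    exact: cvg_within.
  have := cvg_dnbhs_within (sderive_within_cvg (dfx x xab)).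
  apply: cvg_trans; apply: cvg_app; apply: within_subset.
  by move=> s /=; rewrite !in_itv/=; move: a0 bt; lra.
move=> x /andP[ax xb].
have xab : a <= x <= b by rewrite ax ltW.
have xt : 0 <= x < t by rewrite (le_trans a0 ax) (lt_le_trans xb bt).
have : \forall s \near within `[0, t] (dnbhs x), (s - x)^-1 * (f s - f x) < e'.
  exact: (cvgr_lt _ (dfx x xab) e' (le_lt_trans (df0 x xab) e'0)).
move=> /(near_right_itv xt) H; near=> s.
have xs : x < s by near: s; exact: nbhs_right_gt.
have : (s - x)^-1 * (f s - f x) < e' by near: s.
by rewrite mulrC ltr_pdivrMr ?subr_gt0//; lra.
Unshelve. all: by end_near. Qed.

(** * Estimates for the sine *)

Section Trigonometry.
Variable R : realType.
Implicit Types x y c e : R.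

Lemma le_sin_id x : x <= 0 -> x <= sin x.
Proof.
rewrite -oppr_ge0 -[x <= sin x]lerN2 -sinN; move: (- x) => {}x x0.
have [c _ E] := @MVT_segment R (@sin R) (@cos R) 0 x x0
  (fun u _ => is_derive_sin u) (continuous_subspaceT (@continuous_sin R)).
by move: E; rewrite sin0 !subr0 => ->; rewrite ler_piMl// cos_le1.
Qed.

Lemma sin_lipschitz x y : `|sin x - sin y| <= `|x - y|.
Proof.
wlog xy : x y / x <= y.
  by move=> H; have [/H //|/ltW/H] := leP x y; rewrite distrC (distrC y).
have [c _ E] := @MVT_segment R (@sin R) (@cos R) x y xy
  (fun u _ => is_derive_sin u) (continuous_subspaceT (@continuous_sin R)).
by rewrite distrC E (distrC x) normrM ler_piMl// cos_max.
Qed.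

Lemma sin_lt0 x : `|x| < pi -> sin x < 0 -> x < 0.
Proof.
move=> xpi; apply: contraTT; rewrite -!leNgt => x0.
by apply: sin_ge0_pi; rewrite x0 ltW// (le_lt_trans (ler_norm x)).
Qed.

Lemma sin_le0 x : `|x| < pi -> sin x <= 0 -> x <= 0.
Proof.
move=> xpi; apply: contraTT; rewrite -!ltNge => x0.
by apply: sin_gt0_pi; rewrite x0 (le_lt_trans (ler_norm x)).
Qed.

Lemma cos_neq0_of_le x : `|sin x| <= `|cos x| -> cos x != 0.
Proof.
move=> h; apply/eqP => c0; move: h; rewrite c0 normr0 normr_le0 => /eqP s0.
by have /eqP := cos2Dsin2 x; rewrite c0 s0 expr0n addr0 eq_sym oner_eq0.
Qed.

(** A continuous path of angles along which the cosine does not vanish cannot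
    leave the interval of length pi centred at a zero c of the sine. *)
Lemma IVT_branch (f : R -> R) (a b c : R) : a <= b ->
  {within `[a, b], continuous f} ->
  (forall x, a <= x <= b -> cos (f x) != 0) -> sin c = 0 ->
  `|f b - c| < pi / 2 -> `|f a - c| < pi / 2.
Proof.
move=> ab cf hc sc; rewrite !ltr_norml => /andP[h1 h2].
have no v : cos v = 0 -> Num.min (f a) (f b) <= v <= Num.max (f a) (f b) -> False.
  move=> cv hv; have [x xab fx] := IVT ab cf hv.
  have := hc x; rewrite fx cv eqxx => h.
  by have : false by apply: h; move: xab; rewrite in_itv.
have cp : cos (c + pi / 2) = 0 by rewrite cosDpihalf sc oppr0.
have cm : cos (c - pi / 2) = 0 by rewrite cosBpihalf sc.
apply/andP; split; rewrite ltNge; apply/negP => h.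
  by apply: (no _ cm); rewrite ge_min le_max; apply/andP; split; apply/orP; [left|right]; lra.
by apply: (no _ cp); rewrite ge_min le_max; apply/andP; split; apply/orP; [right|left]; lra.
Qed.

Lemma norm_sin_shift c x : sin c = 0 -> `|sin x| = `|sin (x - c)|.
Proof.
move=> sc; rewrite sinB sc mulr0 subr0 normrM (sin0cos1 sc) mulr1.
by [].
Qed.

Lemma sin_norm_mono e x : 0 < e -> e <= `|x| -> `|x| < pi / 2 ->
  sin e <= `|sin x|.
Proof.
move=> e0 ex xp.
have -> : `|sin x| = sin `|x|.
  have h : 0 <= sin `|x|.
    by apply: sin_ge0_pi; rewrite normr_ge0/=; have := pi_gt0 R; lra.
  have [x0|x0] := leP 0 x; first by rewrite (ger0_norm x0) ger0_norm// -(ger0_norm x0).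
  by rewrite (ltr0_norm x0) sinN in h *; rewrite ler0_norm// -oppr_ge0.
rewrite le_eqVlt; have [->|ne] := eqVneq e `|x|; first by rewrite eqxx.
have p0 := pi_gt0 R.
rewrite ltr_sin ?in_itv/= ?lt_neqAle ?ne ?ex ?orbT//; first lra.
have := normr_ge0 x; lra.
Qed.

End Trigonometry.

(** * Eigenvalues and the functional calculus *)

Definition diagonalizes (R : realType) n (P A : 'M[R]_n) (e : 'I_n -> R) :=
  P *m P^T = 1%:M /\ A = P *m diag_mx (\row_i e i) *m P^T.

Section Diagonalize.
Variables (R : realType) (n : nat).
Implicit Types (P A B : 'M[R]_n) (e d : 'I_n -> R) (x : 'rV[R]_n).

Lemma diagonalizes_char_poly P A e :
  diagonalizes P A e -> char_poly A = \prod_(i < n) ('X - (e i)%:P).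
Proof.
move=> [PP ->]; rewrite /char_poly /char_poly_mx !map_mxM/=.
set Q := map_mx polyC P; set D := map_mx polyC (diag_mx _).
have QQ : Q *m (map_mx polyC P^T) = 1%:M by rewrite -map_mxM PP map_mx1.
have -> : 'X%:M - Q *m D *m map_mx polyC P^T =
    Q *m ('X%:M - D) *m map_mx polyC P^T.
  by rewrite mulmxBr mulmxBl mul_mx_scalar -scalemxAl QQ scalemx1.
rewrite !det_mulmx mulrAC -det_mulmx QQ det1 mul1r.
rewrite /D map_diag_mx -/(char_poly_mx _) det_trig.
  by apply: eq_bigr => i _; rewrite !mxE eqxx !mulr1n.
apply/is_trig_mxP => i j ij; rewrite !mxE -val_eqE ltn_eqF//.
by rewrite !mulr0n subrr.
Qed.

(** The eigenvalues found in a diagonalization are, up to a permutation, the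
    ordered ones, since both families factor the characteristic polynomial;
    permuting the columns of P puts them in order. *)
Lemma ordered_diagonalizes P A d e :
  diagonalizes P A d -> ordered_eigenvalues A e ->
  exists Q, diagonalizes Q A e.
Proof.
move=> PA [_]; rewrite (diagonalizes_char_poly PA) => Ede.
have /tuple_permP[p /val_inj/esym Ep] :
    perm_eq [tuple e i | i < n] [tuple d i | i < n].
  by apply/prod_XsubC_eq; rewrite !big_map -!enumT !big_enum/= Ede.
have edp i : e i = d (p i).
  have := congr1 (fun s => tnth s i) Ep; rewrite /= !tnth_mktuple.
  by [].
case: PA => PP ->; exists (\matrix_(i, k) P i (p k)).
have PE (D : 'I_n -> R) : P *m diag_mx (\row_i D i) *m P^T =
   (\matrix_(i, k) P i (p k)) *m diag_mx (\row_i D (p i))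
   *m (\matrix_(i, k) P i (p k))^T.
  apply/matrixP => i j; rewrite !mxE (reindex_inj (@perm_inj _ p)).
  apply: eq_bigr => k _; rewrite !mul_mx_diag !mxE.
  by [].
split; last by rewrite PE; congr (_ *m diag_mx _ *m _); apply/rowP => i; rewrite !mxE edp.
have D1 : diag_mx (\row_(i < n) 1) = 1%:M :> 'M[R]_n.
  by rewrite -diag_const_mx; congr diag_mx; apply/rowP => i; rewrite !mxE.
by have := PE (fun=> 1); rewrite /= D1 mulmx1 PP mulmx1 => <-.
Qed.

Lemma symfun_diagonalizes f P A e :
  diagonalizes P A e -> diagonalizes P (symfun f A) (f \o e).
Proof.
move=> [PP AE]; split=> //; apply: is_symfunE.
exists P, (\row_i e i); split=> //.
by congr (_ *m diag_mx _ *m _); apply/rowP => i; rewrite !mxE.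
Qed.

Lemma row_diagonalizes P A e i :
  diagonalizes P A e -> row i P^T *m A = e i *: row i P^T.
Proof.
move=> [PP ->]; rewrite !mulmxA -row_mul (mulmx1C PP).
rewrite -row_mul mul1mx -row_mul; apply/rowP => k.
by rewrite [LHS]mxE mul_diag_mx !mxE.
Qed.

Lemma row_diagonalizes_unit P A e i :
  diagonalizes P A e -> dot (row i P^T) (row i P^T) = 1.
Proof.
move=> [/mulmx1C PP _]; rewrite /dot tr_row trmxK.
have := congr1 (fun M : 'M[R]_n => M i i) PP; rewrite [RHS]mxE eqxx mulr1n => <-.
by rewrite !mxE; apply: eq_bigr => k _; rewrite !mxE.
Qed.

(** In the basis of P, a coordinate of x is zero unless its diagonal entry
    equals e i, and on the others g takes the same value. *)
Lemma row_diagonalizes_eigen P A e i g (x : 'rV[R]_n) :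
  diagonalizes P A e -> x *m A = e i *: x -> x *m symfun g A = g (e i) *: x.
Proof.
move=> PA xA; have [_ ->] := symfun_diagonalizes g PA.
have PP := mulmx1C PA.1.
suff : (x *m P) *m diag_mx (\row_j (g \o e) j) = g (e i) *: (x *m P).
  by move=> H; rewrite !mulmxA H -scalemxAl -mulmxA PA.1 mulmx1.
have : (x *m P) *m diag_mx (\row_j e j) = e i *: (x *m P).
  move: xA; rewrite {1}PA.2 => /(congr1 (mulmx^~ P)).
  by rewrite -!mulmxA PP mulmx1 !mulmxA -scalemxAl.
move: (x *m P) => y /rowP H; apply/rowP => k; have := H k.
rewrite !mul_mx_diag !mxE => /eqP; rewrite mulrC -subr_eq0 -mulrBl mulf_eq0.
by rewrite subr_eq0 => /orP[/eqP <-|/eqP ->]; rewrite /= ?mulr0 ?mul0r// mulrC.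
Qed.

Lemma diagonalizes_dot P A e x : diagonalizes P A e ->
  dot (x *m P^T *m A) (x *m P^T) = \sum_i e i * x ord0 i ^+ 2.
Proof.
move=> [PP ->]; rewrite !mulmxA -(mulmxA x P^T P) (mulmx1C PP) mulmx1.
rewrite dot_mull trmxK -mulmxA (mulmx1C PP) mulmx1 dotE.
by apply: eq_bigr => i _; rewrite mul_mx_diag !mxE; ring.
Qed.

Lemma dot_orthogonal P x : P *m P^T = 1%:M ->
  dot (x *m P^T) (x *m P^T) = \sum_i x ord0 i ^+ 2.
Proof.
move=> PP; rewrite dot_mull trmxK -mulmxA (mulmx1C PP) mulmx1 dotE.
by apply: eq_bigr => i _; rewrite expr2.
Qed.

(** Weyl's inequality.  There is a nonzero x in the span of the eigenvectors of A
    of index at least j which also lies in the span of those of B of index at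
    most j, because the dimensions n - j and j + 1 add up to n + 1.  On x the
    form of A is at least e j |x|^2 and that of B at most d j |x|^2. *)
Lemma weyl P A e Q B d c j :
  diagonalizes P A e -> diagonalizes Q B d ->
  {homo e : i k / (i <= k)%N >-> i <= k} ->
  {homo d : i k / (i <= k)%N >-> i <= k} ->
  (forall x, dot (x *m A) x <= dot (x *m B) x + c * dot x x) ->
  e j <= d j + c.
Proof.
move=> PA QB he hd AB.
pose W := P^T *m Q.
(* A row vector a killed by K has a_i = 0 for i < j and (a W)_i = 0 for i > j;
   the zero column j makes K singular. *)
pose K : 'M[R]_n := \matrix_(k, i)
  if (i < j)%N then (k == i)%:R else if i == j then 0 else W k i.
have [a a0 aK] : exists2 a : 'rV[R]_n, a != 0 & a *m K = 0.
  apply/det0P; rewrite -det_tr; apply/det0P; exists (delta_mx ord0 j).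
    by apply/eqP => /rowP/(_ j); rewrite !mxE !eqxx/=; apply/eqP; rewrite oner_eq0.
  apply/rowP => k; rewrite -rowE !mxE ltnn eqxx.
  by [].
have a_lt (i : 'I_n) : (i < j)%N -> a ord0 i = 0.
  move=> ij; move/rowP/(_ i): aK; rewrite !mxE (bigD1 i)//= !mxE ij eqxx mulr1.
  rewrite big1 ?addr0// => k ki; rewrite !mxE ij (negbTE ki) mulr0.
  by [].
pose b := a *m W.
have b_gt (i : 'I_n) : (j < i)%N -> b ord0 i = 0.
  move=> ji; transitivity ((a *m K) ord0 i); last by rewrite aK mxE.
  rewrite /b [LHS]mxE [RHS]mxE; apply: eq_bigr => k _; congr (_ * _).
  by rewrite [RHS]mxE ltnNge (ltnW ji)/= -val_eqE gtn_eqF.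
have xE : a *m P^T = b *m Q^T.
  by rewrite /b /W -!mulmxA QB.1 mulmx1.
have S0 : 0 < \sum_i a ord0 i ^+ 2.
  by rewrite -dot_gt0 dotE in a0; rewrite (eq_bigr _ (fun i _ => expr2 _)).
have := AB (a *m P^T).
rewrite (diagonalizes_dot _ PA) {1 2}xE (diagonalizes_dot _ QB) => H.
have Sab : \sum_i a ord0 i ^+ 2 = \sum_i b ord0 i ^+ 2.
  by rewrite -(dot_orthogonal _ PA.1) xE (dot_orthogonal _ QB.1).
rewrite (dot_orthogonal _ PA.1) in H.
rewrite -(ler_pM2r S0); apply: (@le_trans _ _ (\sum_i e i * a ord0 i ^+ 2)).
  rewrite mulr_sumr; apply: ler_sum => i _.
  have [ij|ji] := ltnP i j; first by rewrite a_lt// expr0n !mulr0.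
  by rewrite ler_wpM2r ?sqr_ge0// he.
apply: (le_trans H); rewrite mulrDl lerD2r Sab mulr_sumr.
apply: ler_sum => i _.
have [ij|ji] := leqP i j; last by rewrite b_gt// expr0n !mulr0.
by rewrite ler_wpM2r ?sqr_ge0// hd.
Qed.

Lemma weyl_norm P A e Q B d j :
  diagonalizes P A e -> diagonalizes Q B d ->
  {homo e : i k / (i <= k)%N >-> i <= k} ->
  {homo d : i k / (i <= k)%N >-> i <= k} ->
  `|e j - d j| <= `|A - B| * n%:R.
Proof.
move=> PA QB he hd.
have h x : `|dot (x *m A) x - dot (x *m B) x| <= `|A - B| * n%:R * dot x x.
  by rewrite -dotBl -mulmxBr; exact: dot_mul_le_norm.
have h1 : e j <= d j + `|A - B| * n%:R.
  apply: (weyl _ PA QB) => // x; have := h x; rewrite ler_norml; lra.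
have h2 : d j <= e j + `|A - B| * n%:R.
  apply: (weyl _ QB PA) => // x; have := h x; rewrite ler_norml; lra.
by rewrite ler_norml; lra.
Qed.

Definition frobenius A := \sum_i dot (row i A) (row i A).

Lemma frobeniusE A : frobenius A = \sum_i \sum_j A i j ^+ 2.
Proof.
apply: eq_bigr => i _; rewrite dotE; apply: eq_bigr => j _.
by rewrite !mxE expr2.
Qed.

Lemma frobenius_mulmxr A Q : Q *m Q^T = 1%:M -> frobenius (A *m Q) = frobenius A.
Proof.
move=> QQ; apply: eq_bigr => i _.
by rewrite row_mul dot_mull -mulmxA QQ mulmx1.
Qed.

Lemma frobenius_trmx A : frobenius A^T = frobenius A.
Proof.
rewrite !frobeniusE exchange_big; apply: eq_bigr => i _; apply: eq_bigr => j _.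
by rewrite mxE.
Qed.

Lemma frobenius_mulmxl A Q : Q^T *m Q = 1%:M -> frobenius (Q *m A) = frobenius A.
Proof.
move=> QQ; rewrite -frobenius_trmx trmx_mul frobenius_mulmxr ?trmxK//.
exact: frobenius_trmx.
Qed.

(** With W = P^T Q, which is orthogonal, P^T (f A - f B) Q has the entries
    (f (e i) - f (d j)) W_ij, so a Lipschitz bound on f carries over to the
    Frobenius norm with the same constant, even if A and B do not commute. *)
Lemma frobenius_symfun_lipschitz f P A e Q B d :
  (forall a b, `|f a - f b| <= `|a - b|) ->
  diagonalizes P A e -> diagonalizes Q B d ->
  frobenius (symfun f A - symfun f B) <= frobenius (A - B).
Proof.
move=> lip PA QB.
have key C D c c' : diagonalizes P C c -> diagonalizes Q D c' ->
    frobenius (C - D) =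
    \sum_i \sum_j ((c i - c' j) * (P^T *m Q) i j) ^+ 2.
  move=> [PP ->] [QQ ->].
  rewrite -(@frobenius_mulmxl _ P^T) ?trmxK//.
  rewrite -(@frobenius_mulmxr _ Q)// frobeniusE.
  apply: eq_bigr => i _; apply: eq_bigr => j _; congr (_ ^+ 2).
  rewrite mulmxBr mulmxBl !mulmxA (mulmx1C PP) mul1mx.
  rewrite -(mulmxA (P^T *m Q *m _)) (mulmx1C QQ) mulmx1 -mulmxA.
  move: (P^T *m Q) => W.
  by rewrite mul_diag_mx mul_mx_diag !mxE; ring.
rewrite (key _ _ _ _ (symfun_diagonalizes f PA) (symfun_diagonalizes f QB)).
rewrite (key _ _ _ _ PA QB); apply: ler_sum => i _; apply: ler_sum => j _.
rewrite !exprMn ler_wpM2r ?sqr_ge0//=.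
rewrite -[leLHS]real_normK ?num_real// -[leRHS]real_normK ?num_real//.
by rewrite ler_pXn2r ?nnegrE.
Qed.

Lemma symfun_lipschitz f P A e Q B d i j :
  (forall a b, `|f a - f b| <= `|a - b|) ->
  diagonalizes P A e -> diagonalizes Q B d ->
  `|(symfun f A - symfun f B) i j| <= `|A - B| * n%:R.
Proof.
move=> lip PA QB.
rewrite -(@ler_pXn2r _ 2)// ?nnegrE ?mulr_ge0// real_normK ?num_real//.
apply: (@le_trans _ _ (frobenius (symfun f A - symfun f B))).
  rewrite frobeniusE (bigD1 i)//= (bigD1 j)//= -addrA lerDl addr_ge0//.
    by apply: sumr_ge0 => ? _; rewrite sqr_ge0.
  by apply: sumr_ge0 => ? _; apply: sumr_ge0 => ? _; rewrite sqr_ge0.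
apply: (le_trans (frobenius_symfun_lipschitz lip PA QB)).
rewrite frobeniusE.
apply: (@le_trans _ _ (\sum_(k < n) \sum_(l < n) `|A - B| ^+ 2)).
  apply: ler_sum => k _; apply: ler_sum => l _.
  rewrite -[leLHS]real_normK ?num_real// ler_pXn2r ?nnegrE//.
  rewrite [leRHS]/Num.norm/= mx_normrE.
  exact: (le_bigmax _ (fun ij => `|(A - B) ij.1 ij.2|) (k, l)).
rewrite !sumr_const card_ord -mulrnA -[leLHS]mulr_natr natrM exprMn.
by rewrite expr2 (expr2 n%:R).
Qed.

End Diagonalize.

(** * Uniform bounds and the Wronskian *)

Lemma cvg_within_comp (X Y : topologicalType) (T : Type) (A : set X)
    (f : X -> Y) (g : T -> X) (F : set_system T) (x : X) :
  Filter F -> {within A, continuous f} -> A x -> g @ F --> x ->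
  (\forall s \near F, A (g s)) -> f (g s) @[s --> F] --> f x.
Proof.
move=> FF /subspace_continuousP cf Ax gx Ag U /(cf x Ax) Ux.
have {}Ux : nbhs x [set y | A y -> U (f y)] := Ux.
have FU : F [set s | A (g s) -> U (f (g s))] := gx _ Ux.
by apply: filterS2 Ag FU => s As; apply.
Qed.

Section UniformForms.
Variables (R : realType) (n : nat) (t : R) (A : R -> 'M[R]_n).
Hypothesis cA : {within `[0, t], continuous A}.

(** The minimum over the compact set [0, t] times the unit sphere. *)
Lemma form_min : exists c, (forall (s : R) (x : 'rV[R]_n), 0 <= s <= t ->
    c * dot x x <= dot (x *m A s) x) /\
  ((forall s : R, 0 <= s <= t -> posdefmx (A s)) -> 0 < c).
Proof.
pose S := [set x : 'rV[R]_n | dot x x = 1].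
pose K := `[0, t] `*` S.
pose f (z : R * 'rV[R]_n) := dot (z.2 *m A z.1) z.2.
have cK : compact K.
  by apply: compact_setX; [exact: segment_compact|exact: unit_sphere_compact].
(* K is empty when n = 0 or t < 0 *)
have [K0|/set0P nK] := eqVneq K set0.
  exists 1; split=> // s x st; have [->|x0] := eqVneq x 0.
    by rewrite mul0mx !dot0l mulr0.
  have : K (s, (Num.sqrt (dot x x))^-1 *: x).
    split; rewrite /= ?in_itv//= /S/= dotZl dotZr mulrA -expr2 exprVn.
    by rewrite sqr_sqrtr ?dot_ge0// mulVf// dot_eq0.
  by rewrite K0.
have cf : {within K, continuous f}.
  apply/subspace_continuousP => -[s x] [/= st Sx].
  have hz : z @[z --> within K (nbhs (s, x))] --> (s, x) by exact: cvg_within.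
  have hx : z.2 @[z --> within K (nbhs (s, x))] --> x.
    exact: (cvg_comp _ _ hz (@cvg_snd _ _ (nbhs s) (nbhs x) _)).
  apply: cvg_dot => //; apply: cvg_mulmx => //.
  apply: (cvg_within_comp (A := `[0, t])) => //.
    exact: (cvg_comp _ _ hz (@cvg_fst _ _ (nbhs s) (nbhs x) _)).
  by near=> z; have [] : K z by near: z; exact: withinT.
have [[s0 x0] /[!inE] -[/= s0t Sx0] fmin] := compact_EVT_min nK cK cf.
exists (f (s0, x0)); split.
  move=> s x st; have [->|x_neq0] := eqVneq x 0.
    by rewrite mul0mx !dot0l mulr0.
  have xx : 0 < dot x x by rewrite dot_gt0.
  have := fmin (s, (Num.sqrt (dot x x))^-1 *: x).
  rewrite inE /f/= => h.
  rewrite -ler_pdivlMr//; apply: le_trans (h _) _.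
    split; rewrite /= ?in_itv//= /S/= dotZl dotZr mulrA -expr2 exprVn.
    by rewrite sqr_sqrtr ?dot_ge0// mulVf// gt_eqF.
  rewrite -scalemxAl dotZl dotZr mulrA -expr2 exprVn sqr_sqrtr ?dot_ge0//.
  by rewrite mulrC.
move=> pA; rewrite /f/=; apply: (pA s0 _).2; first by rewrite in_itv/= in s0t.
by apply/eqP => x00; move: Sx0; rewrite /S/= x00 dot0l => /eqP; rewrite eq_sym oner_eq0.
Unshelve. all: by end_near. Qed.

End UniformForms.

Lemma dot_mx_eq0 (R : realType) n (M : 'M[R]_n) :
  (forall y z, dot (y *m M) z = 0) -> M = 0.
Proof.
move=> H; apply/row_matrixP => i; apply/eqP.
by rewrite row0 -dot_eq0 rowE H.
Qed.

Section Frames.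
Variables (R : realType) (n : nat) (t : R) (C D E : R -> 'M[R]_n).

(** The transposed form of the Hamiltonian system: U = q^T and V = p^T, so that
    a row vector y selects the vector solution (y U, y V). *)
Definition frame (lam : R) (U V : R -> 'M[R]_n) : Prop :=
  forall s : R, 0 <= s <= t ->
    is_derive_within `[0, t] U s (V s *m C s) /\
    is_derive_within `[0, t] V s (- (U s *m (- D s + lam *: E s))).

Definition wronskian (U0 V0 U1 V1 : 'M[R]_n) := U0 *m V1^T - V0 *m U1^T.

Hypothesis symC : forall s : R, 0 <= s <= t -> (C s)^T = C s.
Hypothesis symD : forall s : R, 0 <= s <= t -> (D s)^T = D s.
Hypothesis symE : forall s : R, 0 <= s <= t -> (E s)^T = E s.

Lemma frame_of_solutions lam (a b : 'M[R]_n) (Qc Pc Qs Ps : R -> 'M[R]_n) :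
  hamiltonian_solution t C D E lam Qc Pc ->
  hamiltonian_solution t C D E lam Qs Ps ->
  frame lam (fun s => a *m (Qc s)^T - b *m (Qs s)^T)
            (fun s => a *m (Pc s)^T - b *m (Ps s)^T).
Proof.
move=> hc hs s st; have [dQc dPc] := hc s st; have [dQs dPs] := hs s st.
split.
  have := derive_withinB (derive_within_mulmxl (B := a) (derive_within_trmx dQc))
    (derive_within_mulmxl (B := b) (derive_within_trmx dQs)).
  by rewrite !trmx_mul symC// !mulmxA -mulmxBl.
have := derive_withinB (derive_within_mulmxl (B := a) (derive_within_trmx dPc))
  (derive_within_mulmxl (B := b) (derive_within_trmx dPs)).
set M := - D s + lam *: E s.
have MT : M^T = M.
  by rewrite /M linearD/= linearN/= linearZ/= symD// symE.
by rewrite !linearN/= !trmx_mul MT !mulmxA mulmxBl opprD -!mulmxN.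
Qed.

(** The terms in C and D cancel by symmetry; only the difference of the two
    potentials, (l1 - l0) E, survives. *)
Lemma wronskian_derive l0 l1 (U0 V0 U1 V1 : R -> 'M[R]_n) (s : R) :
  frame l0 U0 V0 -> frame l1 U1 V1 -> 0 <= s <= t ->
  is_derive_within `[0, t]
    (fun s => wronskian (U0 s) (V0 s) (U1 s) (V1 s)) s
    (- ((l1 - l0) *: (U0 s *m E s *m (U1 s)^T))).
Proof.
move=> h0 h1 st; have [dU0 dV0] := h0 s st; have [dU1 dV1] := h1 s st.
pose M l := - D s + l *: E s.
have MT l : (M l)^T = M l.
  by rewrite /M linearD/= linearN/= linearZ/= symD// symE.
have := derive_withinB
  (derive_within_mulmx dU0 (derive_within_trmx dV1))
  (derive_within_mulmx dV0 (derive_within_trmx dU1)).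
congr (is_derive_within _ _ _ _).
rewrite -/(M l0) -/(M l1) linearN/= !trmx_mul symC// MT.
rewrite /M !(mulmxN, mulNmx, mulmxDr, mulmxDl) -!scalemxAr -!scalemxAl -!scalemxAr.
rewrite !mulmxA.
set X := V0 s *m _ *m _; set Y := U0 s *m D s *m _; set Z := U0 s *m E s *m _.
by apply/matrixP => i j; rewrite !mxE; ring.
Qed.

Lemma wronskian_const lam (U0 V0 U1 V1 : R -> 'M[R]_n) (s : R) :
  frame lam U0 V0 -> frame lam U1 V1 -> 0 <= s <= t ->
  wronskian (U0 s) (V0 s) (U1 s) (V1 s) = wronskian (U0 0) (V0 0) (U1 0) (V1 0).
Proof.
move=> h0 h1 /andP[s0 st].
pose W s := wronskian (U0 s) (V0 s) (U1 s) (V1 s).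
have dW x : 0 <= x <= t -> is_derive_within `[0, t] W x 0.
  move=> xt; have := wronskian_derive h0 h1 xt.
  by rewrite subrr scale0r oppr0.
suff H y z : dot (y *m W s) z <= dot (y *m W 0) z.
  apply/eqP; rewrite -subr_eq0; apply/eqP; apply: dot_mx_eq0 => y z.
  rewrite mulmxBr dotBl; apply/eqP; rewrite subr_eq0 eq_le H/=.
  by have := H (- y) z; rewrite !mulNmx !dotNl lerN2.
apply: (@sderive_within_noninc _ t 0 s (fun s => dot (y *m W s) z) (fun=> 0)) => //.
move=> x /andP[x0 xs].
have := sderive_within_dot (y := y) (z := z) (dW x _); rewrite mulmx0 dot0l; apply.
by rewrite x0 (le_trans xs).
Qed.

End Frames.

(** * The polar angle and its eigenvalues *)

(** The data of the polar decomposition of the boundary matrices, with the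
    ordered eigenvalues ev of phi.  Here - U and U delta + V are Q1 and Q2. *)
Record polar_angle (R : realType) n (t : R) (delta : 'M[R]_n)
    (U V r phi : R -> R -> 'M[R]_n) (ev : R -> R -> 'I_n -> R) : Prop :=
  PolarAngle {
  polar_continuous_r : {within `[0, t] `*` [set: R],
    continuous (fun z : R * R => r z.1 z.2)};
  polar_continuous_phi : {within `[0, t] `*` [set: R],
    continuous (fun z : R * R => phi z.1 z.2)};
  polar_delta_sym : delta^T = delta;
  polar_det : forall s lam : R, 0 <= s <= t -> \det (r s lam) != 0;
  polar_sin : forall s lam : R, 0 <= s <= t ->
    - U s lam = r s lam *m symfun sin (phi s lam);
  polar_cos : forall s lam : R, 0 <= s <= t ->
    U s lam *m delta + V s lam = r s lam *m symfun cos (phi s lam);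
  polar_diag : forall s lam : R, 0 <= s <= t ->
    exists P, diagonalizes P (phi s lam) (ev s lam);
  polar_sorted : forall s lam : R, 0 <= s <= t ->
    {homo ev s lam : i j / (i <= j)%N >-> i <= j} }.

Section Angle.
Variables (R : realType) (n : nat) (t : R) (delta : 'M[R]_n).
Variables (U V r phi : R -> R -> 'M[R]_n) (ev : R -> R -> 'I_n -> R).
Hypothesis pa : polar_angle t delta U V r phi ev.

Let K : set (R * R) := `[0, t] `*` [set: R].
Let cr := polar_continuous_r pa.
Let cphi := polar_continuous_phi pa.
Let symdelta := polar_delta_sym pa.
Let detr := polar_det pa.
Let hQ1 := polar_sin pa.
Let hQ2 := polar_cos pa.
Let hdiag := polar_diag pa.
Let hev := polar_sorted pa.

Lemma phi_cvg T (F : set_system T) (p q : T -> R) (s0 l0 : R) :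
  Filter F -> 0 <= s0 <= t -> p @ F --> s0 -> q @ F --> l0 ->
  (\forall z \near F, 0 <= p z <= t) ->
  phi (p z) (q z) @[z --> F] --> phi s0 l0.
Proof.
move=> FF st hp hq pt.
apply: (@cvg_within_comp (R * R)%type 'M[R]_n T K (fun z : R * R => phi z.1 z.2)
  (fun z => (p z, q z)) F (s0, l0)) => //.
  exact: (cvg_pair hp hq).
by apply: filterS pt => z pz; split; rewrite //= in_itv.
Qed.

Lemma r_cvg T (F : set_system T) (p q : T -> R) (s0 l0 : R) :
  Filter F -> 0 <= s0 <= t -> p @ F --> s0 -> q @ F --> l0 ->
  (\forall z \near F, 0 <= p z <= t) ->
  r (p z) (q z) @[z --> F] --> r s0 l0.
Proof.
move=> FF st hp hq pt.
apply: (@cvg_within_comp (R * R)%type 'M[R]_n T K (fun z : R * R => r z.1 z.2)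
  (fun z => (p z, q z)) F (s0, l0)) => //.
  exact: (cvg_pair hp hq).
by apply: filterS pt => z pz; split; rewrite //= in_itv.
Qed.

(** Eigenvalues and functions of phi are both controlled by the norm of the
    increment of phi, with the same constant n. *)
Lemma squeeze_phi T (F : set_system T) (p q : T -> R) (s0 l0 : R) (g : T -> R) (g0 : R) :
  Filter F -> 0 <= s0 <= t -> p @ F --> s0 -> q @ F --> l0 ->
  (\forall z \near F, 0 <= p z <= t) ->
  (\forall z \near F, `|g z - g0| <= `|phi (p z) (q z) - phi s0 l0| * n%:R) ->
  g @ F --> g0.
Proof.
move=> FF st hp hq pt H; apply/cvgrPdist_le => e e0.
have k0 : 0 < e / n.+1%:R by rewrite divr_gt0.
have := phi_cvg FF st hp hq pt => /cvgrPdist_le/(_ _ k0).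
apply: filterS2 H => z H1 H2; rewrite distrC (le_trans H1)// distrC.
apply: (@le_trans _ _ (e / n.+1%:R * n%:R)); first by rewrite ler_wpM2r.
by rewrite mulrAC ler_pdivrMr// ler_wpM2l ?ltW// ltr_nat.
Qed.

Lemma ev_cvg T (F : set_system T) (p q : T -> R) (s0 l0 : R) j :
  Filter F -> 0 <= s0 <= t -> p @ F --> s0 -> q @ F --> l0 ->
  (\forall z \near F, 0 <= p z <= t) ->
  ev (p z) (q z) j @[z --> F] --> ev s0 l0 j.
Proof.
move=> FF st hp hq pt; apply: (squeeze_phi FF st hp hq pt).
apply: filterS pt => z pz.
have [P0 hP0] := hdiag l0 st; have [P hP] := hdiag (q z) pz.
by apply: (weyl_norm _ hP hP0); exact: hev.
Qed.

(** Joint continuity of the solutions in (tau, lambda) is read off from the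
    continuity of r and phi, instead of from the differential equation. *)
Lemma U_cvg T (F : set_system T) (p q : T -> R) (s0 l0 : R) :
  Filter F -> 0 <= s0 <= t -> p @ F --> s0 -> q @ F --> l0 ->
  (\forall z \near F, 0 <= p z <= t) ->
  U (p z) (q z) @[z --> F] --> U s0 l0.
Proof.
move=> FF st hp hq pt.
have -> : U s0 l0 = - (r s0 l0 *m symfun sin (phi s0 l0)) by rewrite -hQ1// opprK.
apply: (@cvg_trans _ (- (r (p z) (q z) *m symfun sin (phi (p z) (q z))) @[z --> F])).
  by apply: near_eq_cvg; apply: filterS pt => z pz; rewrite -hQ1// opprK.
apply: cvgN; apply: cvg_mulmx; first exact: r_cvg.
apply/cvg_mxP => i k; apply: (squeeze_phi FF st hp hq pt).
apply: filterS pt => z pz.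
have [P0 hP0] := hdiag l0 st; have [P hP] := hdiag (q z) pz.
have := symfun_lipschitz i k (@sin_lipschitz R) hP hP0.
by rewrite !mxE.
Qed.

(** The solution (y U, y V) is the one for which (U, U delta + V) has the polar
    angle ev s lam j exactly: y r is an eigenvector of phi. *)
Definition eigenangle (s lam : R) j (y : 'rV[R]_n) :=
  [/\ y *m r s lam != 0,
      y *m U s lam = - sin (ev s lam j) *: (y *m r s lam) &
      y *m V s lam = cos (ev s lam j) *: (y *m r s lam)
        + sin (ev s lam j) *: (y *m r s lam *m delta)].

Lemma eigenangle_eigen s lam j y : 0 <= s <= t -> y != 0 ->
  y *m r s lam *m phi s lam = ev s lam j *: (y *m r s lam) ->
  eigenangle s lam j y.
Proof.
move=> st y0 hy; have [P hP] := hdiag lam st.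
have yU : y *m U s lam = - sin (ev s lam j) *: (y *m r s lam).
  rewrite -[U _ _]opprK hQ1// mulmxN mulmxA.
  by rewrite (row_diagonalizes_eigen sin hP hy) scaleNr.
split=> //.
  apply: contra_neq y0 => /(congr1 (mulmx^~ (invmx (r s lam)))).
  by rewrite mul0mx mulmxK// unitmxE unitfE detr.
have : y *m (U s lam *m delta + V s lam) = cos (ev s lam j) *: (y *m r s lam).
  by rewrite hQ2// mulmxA (row_diagonalizes_eigen cos hP hy).
rewrite mulmxDr mulmxA yU => <-.
by rewrite -scalemxAl scaleNr addrAC addNr add0r.
Qed.

Lemma eigenangle_unit s lam j : 0 <= s <= t -> exists y, [/\ dot y y = 1,
  y *m r s lam *m phi s lam = ev s lam j *: (y *m r s lam) &
  eigenangle s lam j y].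
Proof.
move=> st; have [P hP] := hdiag lam st.
have ru : r s lam \in unitmx by rewrite unitmxE unitfE detr.
pose w := row j P^T *m invmx (r s lam).
have wr : w *m r s lam = row j P^T by rewrite mulmxKV.
have w0 : w != 0.
  apply/eqP => w0; have := row_diagonalizes_unit j hP.
  by rewrite -wr w0 mul0mx dot0l => /esym/eqP; rewrite oner_eq0.
pose y := (Num.sqrt (dot w w))^-1 *: w.
have yy : dot y y = 1.
  rewrite dotZl dotZr mulrA -expr2 exprVn sqr_sqrtr ?dot_ge0// mulVf//.
  by rewrite dot_eq0.
have yphi : y *m r s lam *m phi s lam = ev s lam j *: (y *m r s lam).
  by rewrite /y -!scalemxAl wr (row_diagonalizes j hP) !scalerA mulrC.
exists y; split=> //; apply: eigenangle_eigen => //.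
by rewrite -dot_gt0 yy.
Qed.

(** U0 V1^T - V0 U1^T is unchanged when V is replaced by U delta + V, as delta
    is symmetric; the right-hand side is then the addition formula. *)
Lemma eigenangle_wronskian s0 l0 s1 l1 j y0 y1 :
  eigenangle s0 l0 j y0 -> eigenangle s1 l1 j y1 ->
  dot (y0 *m wronskian (U s0 l0) (V s0 l0) (U s1 l1) (V s1 l1)) y1 =
  sin (ev s1 l1 j - ev s0 l0 j) * dot (y0 *m r s0 l0) (y1 *m r s1 l1).
Proof.
move=> [_ yU0 yV0] [_ yU1 yV1].
rewrite /wronskian mulmxBr !mulmxA dotBl.
rewrite (dot_mull _ _ (V s1 l1)^T) (dot_mull _ _ (U s1 l1)^T) !trmxK.
rewrite yU0 yV0 yU1 yV1.
set v0 := y0 *m r s0 l0; set v1 := y1 *m r s1 l1.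
have sd : dot (v0 *m delta) v1 = dot v0 (v1 *m delta).
  by rewrite dot_mull symdelta.
rewrite !dotDl !dotDr !dotZl !dotZr sd sinB; ring.
Qed.

(** To prove a property of the j-th eigenvalue near a point, one may assume that
    eigenvectors converge.  The unit vectors are the y z, not the y z r: this
    avoids the continuity of the inverse of r, and the limit of y z r is
    nonzero because r is invertible. *)
Lemma near_eigenangle T (F : set_system T) (p q : T -> R) (s0 l0 : R) j
    (P : T -> Prop) :
  ProperFilter F -> 0 <= s0 <= t -> p @ F --> s0 -> q @ F --> l0 ->
  (\forall z \near F, 0 <= p z <= t) ->
  (forall (G : set_system T) (y : T -> 'rV[R]_n) (y0 : 'rV[R]_n),
    ProperFilter G -> F `<=` G -> y @ G --> y0 -> dot y0 y0 = 1 ->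
    eigenangle s0 l0 j y0 ->
    dot (y0 *m r s0 l0) (y z *m r (p z) (q z)) @[z --> G] -->
      dot (y0 *m r s0 l0) (y0 *m r s0 l0) ->
    (\forall z \near G,
      [/\ 0 < dot (y0 *m r s0 l0) (y z *m r (p z) (q z)),
          `|ev (p z) (q z) j - ev s0 l0 j| < pi &
          dot (y0 *m wronskian (U s0 l0) (V s0 l0) (U (p z) (q z)) (V (p z) (q z)))
            (y z) =
          sin (ev (p z) (q z) j - ev s0 l0 j)
            * dot (y0 *m r s0 l0) (y z *m r (p z) (q z))]) ->
    \forall z \near G, P z) ->
  \forall z \near F, P z.
Proof.
move=> PF st hp hq pt H.
have exy z : exists y, 0 <= p z <= t -> [/\ dot y y = 1,
    y *m r (p z) (q z) *m phi (p z) (q z)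
      = ev (p z) (q z) j *: (y *m r (p z) (q z)) &
    eigenangle (p z) (q z) j y].
  have [pz|/negP pz] := boolP (0 <= p z <= t).
    by have [y hy] := eigenangle_unit (q z) j pz; exists y.
  by exists 0.
have [y hy] := choice exy.
apply: (@near_unit_sphere _ _ _ F y P PF).
  by apply: filterS pt => z /hy[].
move=> G y0 PG FG y01 yG.
have ptG : \forall z \near G, 0 <= p z <= t by exact: FG.
have hpG : p @ G --> s0 by apply: cvg_trans hp => A /=; exact: FG.
have hqG : q @ G --> l0 by apply: cvg_trans hq => A /=; exact: FG.
have FFG : Filter G by exact: _.
have rG := r_cvg FFG st hpG hqG ptG.
have evG := ev_cvg (j := j) FFG st hpG hqG ptG.
have vG : y z *m r (p z) (q z) @[z --> G] --> y0 *m r s0 l0 by exact: cvg_mulmx.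
have y0E : eigenangle s0 l0 j y0.
  apply: eigenangle_eigen => //; first by rewrite -dot_gt0 y01.
  have h1 := cvg_mulmx (FF := FFG) vG (phi_cvg FFG st hpG hqG ptG).
  have h2 : ev (p z) (q z) j *: (y z *m r (p z) (q z)) @[z --> G] -->
    ev s0 l0 j *: (y0 *m r s0 l0) by exact: cvgZ.
  have h3 : y z *m r (p z) (q z) *m phi (p z) (q z) @[z --> G] -->
    ev s0 l0 j *: (y0 *m r s0 l0).
    apply: cvg_trans h2; apply: near_eq_cvg.
    by apply: filterS ptG => z /hy[].
  exact: (norm_cvg_unique h1 h3).
have dG : dot (y0 *m r s0 l0) (y z *m r (p z) (q z)) @[z --> G] -->
    dot (y0 *m r s0 l0) (y0 *m r s0 l0).
  by apply: cvg_dot => //; exact: cvg_cst.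
apply: (H G y y0) => //.
have d0 : 0 < dot (y0 *m r s0 l0) (y0 *m r s0 l0) by rewrite dot_gt0; case: y0E.
near=> z; split.
- by near: z; exact: (cvgr_gt _ dG).
- by rewrite distrC; near: z; move/cvgrPdist_lt : evG; apply; exact: pi_gt0.
- apply: eigenangle_wronskian => //.
  have pz : 0 <= p z <= t by near: z.
  by have [] := hy z pz.
Unshelve. all: by end_near. Qed.

End Angle.

(** * The modified angle *)

Section Prufer.
Variables (R : realType) (sg : R).
Hypothesis sg1 : 1 <= sg.
Implicit Types x y : R.

(** The continuous branch of arctan (sg tan x) that is fixed at the multiples of
    pi / 2; the formula for it is the subtraction formula of the tangent. *)
Definition prufer x : R :=
  x + atan ((sg - 1) * (sin x * cos x) / (cos x ^+ 2 + sg * sin x ^+ 2)).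

Definition prufer_rate x : R := cos x ^+ 2 + sg ^+ 2 * sin x ^+ 2.

Lemma prufer_rate_gt0 x : 0 < prufer_rate x.
Proof.
have := cos2Dsin2 x; rewrite /prufer_rate.
have : 1 <= sg ^+ 2 by rewrite exprn_ege1.
have h0 := sqr_ge0 (sin x) => h1 h2.
have : 0 <= (sg ^+ 2 - 1) * sin x ^+ 2 by rewrite mulr_ge0 ?sqr_ge0// subr_ge0.
by lra.
Qed.

(** This is the point of the modified angle: an angle x moving at the speed
    prufer_rate x has a modified angle moving at the constant speed sg. *)
Lemma is_derive_prufer x : is_derive x 1 prufer (sg / prufer_rate x).
Proof.
have w0 : 0 < cos x ^+ 2 + sg * sin x ^+ 2.
  have := cos2Dsin2 x; have := sqr_ge0 (sin x).
  have : 0 <= (sg - 1) * sin x ^+ 2 by rewrite mulr_ge0 ?sqr_ge0// subr_ge0.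
  by lra.
pose w : R -> R := (@cos R) ^+ 2 + sg \*: ((@sin R) ^+ 2).
pose u : R -> R := (sg - 1) \*: ((@sin R) * (@cos R)).
pose v : R -> R := u * (fun y => (w y)^-1).
have wx : w x != 0 by rewrite gt_eqF.
have dw : is_derive x 1 w (2 * (sg - 1) * (sin x * cos x)).
  by apply: trigger_derive; rewrite /GRing.scale/=; ring.
have du : is_derive x 1 u ((sg - 1) * (cos x ^+ 2 - sin x ^+ 2)).
  by apply: trigger_derive; rewrite /GRing.scale/=; ring.
have dv := is_deriveM du (is_deriveV wx dw).
have da := is_derive1_comp (is_derive1_atan (v x)) dv.
have := is_deriveD (is_derive_id x 1) da.
have -> : id + (@atan R \o v) = prufer by apply/funext => y.
move=> H; apply: (trigger_derive H); rewrite /GRing.scale/=.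
have -> : v x = (sg - 1) * (sin x * cos x) / (cos x ^+ 2 + sg * sin x ^+ 2) by [].
have -> : u x = (sg - 1) * (sin x * cos x) by [].
have -> : w x = cos x ^+ 2 + sg * sin x ^+ 2 by [].
have r0 := prufer_rate_gt0 x; rewrite /prufer_rate in r0 *.
have cs := cos2Dsin2 x.
move: (cos x) (sin x) w0 r0 cs => c s w0 r0 cs {H da dv du dw wx u v w}.
have key : 1 + ((sg - 1) * (s * c) / (c ^+ 2 + sg * s ^+ 2)) ^+ 2 =
    (c ^+ 2 + sg ^+ 2 * s ^+ 2) / (c ^+ 2 + sg * s ^+ 2) ^+ 2.
  have -> : c ^+ 2 + sg ^+ 2 * s ^+ 2 =
      (c ^+ 2 + sg ^+ 2 * s ^+ 2) * (c ^+ 2 + s ^+ 2) by rewrite cs mulr1.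
  by field; rewrite gt_eqF.
rewrite key.
set W := c ^+ 2 + sg * s ^+ 2 in w0 *; set Q := c ^+ 2 + sg ^+ 2 * s ^+ 2 in r0 *.
have -> : 1 + (Q / W ^+ 2)^-1 * ((sg - 1) * (s * c) * (- W ^- 2 * (2 * (sg - 1) * (s * c)))
    + W^-1 * ((sg - 1) * (c ^+ 2 - s ^+ 2))) =
    (Q + (sg - 1) * (W * (c ^+ 2 - s ^+ 2) - 2 * (sg - 1) * (s * c) ^+ 2)) / Q.
  by field; rewrite !gt_eqF.
congr (_ / _); rewrite /Q /W.
have c2 : c ^+ 2 = 1 - s ^+ 2 by rewrite -cs addrK.
by rewrite exprMn c2; ring.
Qed.

Lemma prufer_le x y : x <= y -> prufer x <= prufer y.
Proof.
move=> xy.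
have cp : continuous prufer.
  move=> z; apply/differentiable_continuous/derivable1_diffP.
  by apply: ex_derive; exact: is_derive_prufer.
have [c _ E] := @MVT_segment R prufer (fun z => sg / prufer_rate z) x y xy
  (fun z _ => is_derive_prufer z) (continuous_subspaceT cp).
rewrite -subr_ge0 E mulr_ge0 ?subr_ge0// divr_ge0 ?(ltW (prufer_rate_gt0 c))//.
exact: le_trans sg1.
Qed.

Lemma prufer_near x : x - pi / 2 < prufer x < x + pi / 2.
Proof. by rewrite /prufer ltrD2l ltrD2l atan_gtNpi2 atan_ltpi2. Qed.

End Prufer.

(** * Strict decrease in the spectral parameter *)

Section BoundaryProblem.
Variables (R : realType) (n : nat) (t : R) (C D E : R -> 'M[R]_n).
Variables (U V r phi : R -> R -> 'M[R]_n) (alpha beta delta : 'M[R]_n).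
Variable ev : R -> R -> 'I_n -> R.
Hypothesis t0 : 0 < t.
Hypothesis pa : polar_angle t delta U V r phi ev.
Hypothesis cC : {within `[0, t], continuous C}.
Hypothesis cD : {within `[0, t], continuous D}.
Hypothesis cE : {within `[0, t], continuous E}.
Hypothesis posC : forall s : R, 0 <= s <= t -> posdefmx (C s).
Hypothesis symD : forall s : R, 0 <= s <= t -> (D s)^T = D s.
Hypothesis posE : forall s : R, 0 <= s <= t -> posdefmx (E s).
Hypothesis hfr : forall lam, frame t C D E lam (U^~ lam) (V^~ lam).
Hypothesis hU0 : forall lam, U 0 lam = alpha.
Hypothesis hV0 : forall lam, V 0 lam = - beta.
Hypothesis hab : alpha *m beta^T = beta *m alpha^T.
Hypothesis hnd : alpha *m alpha^T + beta *m beta^T = 1%:M.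

Let symC s (st : 0 <= s <= t) := (posC st).1.
Let symE s (st : 0 <= s <= t) := (posE st).1.

Lemma wronskian_init l0 l1 : wronskian (U 0 l0) (V 0 l0) (U 0 l1) (V 0 l1) = 0.
Proof. by rewrite /wronskian !hU0 !hV0 linearN/= mulmxN mulNmx opprK hab addNr. Qed.

Lemma wronskian_diag s lam : 0 <= s <= t ->
  wronskian (U s lam) (V s lam) (U s lam) (V s lam) = 0.
Proof.
move=> st; have := wronskian_const symC symD symE (hfr lam) (hfr lam) st.
by rewrite /= wronskian_init.
Qed.

Lemma U_continuous lam s : 0 <= s <= t ->
  (fun x => U x lam) @ within `[0, t] (nbhs s) --> U s lam.
Proof. by move=> st; exact: (derive_within_continuous (hfr lam st).1). Qed.

Lemma E_continuous s : 0 <= s <= t -> E @ within `[0, t] (nbhs s) --> E s.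
Proof.
by move=> st; move/subspace_continuousP : cE; apply; rewrite /= in_itv.
Qed.

(** If y U vanished near 0, then so would its derivative y V C at 0, hence y V,
    and y would be orthogonal to the initial data, which have full rank. *)
Lemma frame_nonzero lam (y : 'rV[R]_n) (tau : R) : 0 < tau <= t -> y != 0 ->
  exists2 s, 0 <= s < tau & y *m U s lam != 0.
Proof.
move=> /andP[tau0 taut] y0; apply: contrapT => H.
have yU s : 0 <= s < tau -> y *m U s lam = 0.
  by move=> st; apply/eqP; apply: contra_notT H => yU; exists s.
have z0 : (0 : R) <= 0 <= t by rewrite lexx ltW.
pose w := y *m V 0 lam.
have yU0 : y *m alpha = 0 by rewrite -(hU0 lam) yU ?lexx.
have w0 : w = 0.
  apply/eqP; apply: contraT => w_neq0.
  have := sderive_within_dot (y := y) (z := w) (hfr lam z0).1.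
  set d := dot (y *m _) w.
  have d0 : 0 < d by rewrite /d mulmxA; exact: (posC z0).2.
  move=> hd.
  have : \forall s \near within `[0, t] (dnbhs (0 : R)),
      0 < (s - 0)^-1 * (dot (y *m U s lam) w - dot (y *m U 0 lam) w).
    exact: (cvgr_gt _ hd).
  move=> /near_right_itv; rewrite lexx t0 => /(_ isT) h1.
  have h2 : \forall s \near (0:R)^'+, 0 < s by exact: nbhs_right_gt.
  have h3 : \forall s \near (0:R)^'+, s < tau by exact: nbhs_right_lt.
  have [s [[s0 stau]]] := filter_ex (filterI (filterI h2 h3) h1).
  by rewrite /= !yU ?lexx ?tau0 ?stau ?ltW// dot0l subrr mulr0 ltxx.
have yb : y *m beta = 0 by move: w0; rewrite /w hV0 mulmxN => /eqP; rewrite oppr_eq0 => /eqP.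
move: y0; rewrite -[y]mulmx1 -hnd mulmxDr !mulmxA yU0 yb !mul0mx addr0.
by rewrite eqxx.
Qed.

(** In the limit, dot (y0 W) (y l) is - (l - l0) times the integral over [0, tau]
    of the form of E on y0 U, which is positive.  Instead of the integral, the
    monotonicity of a linear correction of dot (y0 W) (y l) is used on three
    intervals: on [s1, s2] the integrand is at least c - eta, elsewhere it is
    at least - eta. *)
Lemma near_wronskian_neg (l0 tau : R) (G : set_system R) (y : R -> 'rV[R]_n)
    (y0 : 'rV[R]_n) :
  0 < tau <= t -> ProperFilter G -> l0^'+ `<=` G -> y @ G --> y0 -> y0 != 0 ->
  \forall l \near G,
    dot (y0 *m wronskian (U tau l0) (V tau l0) (U tau l) (V tau l)) (y l) < 0.
Proof.
move=> taut PG FG yG y0_neq0; have /andP[tau0 taut'] := taut.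
have lG : (l : R) @[l --> G] --> l0.
  by move=> A Al; apply: FG; apply: (@cvg_within _ (nbhs l0)); exact: Al.
have gtG : \forall l \near G, l0 < l by apply: FG; exact: nbhs_right_gt.
pose x s := y0 *m U s l0.
pose h s := dot (x s *m E s) (x s).
have h_ge0 s : 0 <= s <= t -> 0 <= h s.
  move=> st; rewrite /h; have [->|x0] := eqVneq (x s) 0.
    by rewrite mul0mx dot0l.
  by rewrite ltW//; exact: (posE st).2.
have x_cvg s : 0 <= s <= t -> x @ within `[0, t] (nbhs s) --> x s.
  by move=> st; apply: cvg_mulmx; [exact: cvg_cst|exact: U_continuous].
have h_cvg s : 0 <= s <= t -> h @ within `[0, t] (nbhs s) --> h s.
  move=> st; apply: cvg_dot; last exact: x_cvg.
  by apply: cvg_mulmx; [exact: x_cvg|exact: E_continuous].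
have [c [s1 [s2 [c0 s10 s12 s2t hc]]]] : exists c s1 s2, [/\ 0 < c, 0 <= s1, s1 < s2,
    s2 <= tau & forall s, s1 <= s <= s2 -> c <= h s].
  have [s1 /andP[s10 s1t] xs1] := frame_nonzero l0 taut y0_neq0.
  have s1tt : 0 <= s1 <= t by rewrite s10 ltW// (lt_le_trans s1t).
  have hs1 : 0 < h s1 by exact: (posE s1tt).2.
  have : \forall s \near within `[0, t] (nbhs s1), h s1 / 2 < h s.
    by apply: (cvgr_gt _ (h_cvg s1 s1tt)); lra.
  move=> H; have {}H : nbhs s1 [set s | s \in `[0, t] -> h s1 / 2 < h s] := H.
  have /nbhs_ballP[e /= e0 he] := H.
  exists (h s1 / 2), s1, (s1 + Num.min (e / 2) (tau - s1)).
  have m0 : 0 < Num.min (e / 2) (tau - s1) by rewrite lt_min; lra.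
  have m1 : Num.min (e / 2) (tau - s1) <= tau - s1 by rewrite ge_min lexx orbT.
  split=> //; [lra|lra|lra|].
  move=> s /andP[s1s ss2]; apply/ltW/he.
    rewrite /ball/= distrC ger0_norm ?subr_ge0//.
    have : Num.min (e / 2) (tau - s1) <= e / 2 by rewrite ge_min lexx.
    by lra.
  have : Num.min (e / 2) (tau - s1) <= tau - s1 by rewrite ge_min lexx orbT.
  by rewrite in_itv/=; lra.
(* half of the gain c (s2 - s1), spread over [0, tau] *)
pose eta := c * (s2 - s1) / (2 * tau).
have eta0 : 0 < eta by rewrite divr_gt0// mulr_gt0// subr_gt0.
(* The integrands for l converge uniformly on the compact interval [0, t]. *)
have near_h : \forall l \near G, forall s, s \in `[0, t] ->
    h s - eta <= dot (x s *m E s) (y l *m U s l).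
  have /compact_near_coveringP/near_covering_withinP := @segment_compact R 0 t.
  move=> /(_ _ G (fun l s => h s - eta <= dot (x s *m E s) (y l *m U s l)) _) H.
  have {}H : \forall l \near G, `[0, t]%classic `<=`
      (fun s => h s - eta <= dot (x s *m E s) (y l *m U s l)).
    apply: H => s; rewrite /= in_itv/= => st.
    pose F := filter_prod (within `[0, t] (nbhs s)) G.
    have p1 : z.1 @[z --> F] --> s.
      apply: (cvg_trans (@cvg_fst _ _ (within `[0, t] (nbhs s)) G _)).
      exact: cvg_within.
    have p1w : z.1 @[z --> F] --> within `[0, t] (nbhs s).
      exact: cvg_fst.
    have p2 : z.2 @[z --> F] --> l0.
      exact: (cvg_trans (@cvg_snd _ _ (within `[0, t] (nbhs s)) G _)).
    have pin : \forall z \near F, 0 <= z.1 <= t.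
      apply: (p1w (fun s => 0 <= s <= t)).
      by apply: filterS (withinT `[0, t] (nbhs_filter s)) => u; rewrite /= in_itv.
    have xF : x z.1 @[z --> F] --> x s by exact: (cvg_comp _ _ p1w (x_cvg s st)).
    have EF : E z.1 @[z --> F] --> E s by exact: (cvg_comp _ _ p1w (E_continuous st)).
    have UF : U z.1 z.2 @[z --> F] --> U s l0 by exact: (U_cvg pa _ st p1 p2 pin).
    have yF : y z.2 @[z --> F] --> y0.
      exact: (cvg_comp _ _ (@cvg_snd _ _ (within `[0, t] (nbhs s)) G _) yG).
    have dF : dot (x z.1 *m E z.1) (y z.2 *m U z.1 z.2) @[z --> F] --> h s.
      by apply: cvg_dot; apply: cvg_mulmx.
    have hF : h z.1 @[z --> F] --> h s by exact: (cvg_comp _ _ p1w (h_cvg s st)).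
    have : \forall z \near F, h z.1 - eta <= dot (x z.1 *m E z.1) (y z.2 *m U z.1 z.2).
      have e2 : 0 < eta / 2 by lra.
      have n1 : \forall z \near F, h s - eta / 2 < dot (x z.1 *m E z.1) (y z.2 *m U z.1 z.2).
        by apply: (cvgr_gt _ dF); lra.
      have n2 : \forall z \near F, h z.1 < h s + eta / 2.
        by apply: (cvgr_lt _ hF); lra.
      by apply: filterS2 n1 n2 => z; lra.
    move=> [[A B] /= [As BG] AB].
    exists ([set u | u \in `[0, t] -> A u], B) => //= -[u l] /= [Au Bl] ut.
    by apply: (AB (u, l)); split => //=; exact: Au.
  by apply: filterS H => l + s st; apply.
near=> l.
have ll : l0 < l by near: l.
pose W s := wronskian (U s l0) (V s l0) (U s l) (V s l).
pose rho s := dot (y0 *m W s) (y l).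
have drho s : 0 <= s <= t -> is_sderive_within `[0, t] rho s
    (- ((l - l0) * dot (x s *m E s) (y l *m U s l))).
  move=> st; have := wronskian_derive symC symD symE (hfr l0) (hfr l) st.
  move=> /(sderive_within_dot (y := y0) (z := y l)).
  congr (is_sderive_within _ _ _ _).
  rewrite mulmxN dotNl -scalemxAr dotZl; congr (- (_ * _)).
  by rewrite !mulmxA (dot_mull _ _ (U s l)^T) trmxK.
have hl s : 0 <= s <= t -> h s - eta <= dot (x s *m E s) (y l *m U s l).
  by move=> st; apply: (near near_h l _); rewrite // in_itv.
have dec a b k : 0 <= a -> a <= b -> b <= tau -> (forall s, a <= s <= b -> k <= h s) ->
    rho b <= rho a - (l - l0) * (k - eta) * (b - a).
  move=> a0 ab btau hk.
  have := @sderive_within_noninc _ t a b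
     (fun s => rho s - (0 + - ((l - l0) * (k - eta)) * s)) _ a0 ab (le_trans btau taut').
  move=> /(_ (fun s => - ((l - l0) * dot (x s *m E s) (y l *m U s l)) - - ((l - l0) * (k - eta)))).
  have ht s : a <= s <= b -> 0 <= s <= t by lra.
  have hA s : is_sderive_within `[0, t]
      (fun s => 0 + - ((l - l0) * (k - eta)) * s) s (- ((l - l0) * (k - eta))).
    exact: sderive_within_affine.
  move=> H; have {}H := H (fun s sab => sderive_withinB (drho s (ht s sab)) (hA s)).
  have : rho b - (0 + - ((l - l0) * (k - eta)) * b) <=
    rho a - (0 + - ((l - l0) * (k - eta)) * a).
    apply: H => s sab; have := hl s (ht s sab); have := hk s sab => hs1 hs2.
    by rewrite opprK addrC subr_le0 ler_pM2l ?subr_gt0//; lra.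
  by lra.
have tt : s1 <= tau by lra.
have d2 := dec s1 s2 c s10 (ltW s12) s2t hc.
have s20 : 0 <= s2 by lra.
have rho0 : rho 0 = 0 by rewrite /rho /W wronskian_init mulmx0 dot0l.
have d1 : rho s1 <= rho 0 - (l - l0) * (0 - eta) * (s1 - 0).
  by apply: dec => // s /andP[s0 ss1]; apply: h_ge0; lra.
have d3 : rho tau <= rho s2 - (l - l0) * (0 - eta) * (tau - s2).
  by apply: dec => // s /andP[s2s stau]; apply: h_ge0; lra.
have etaE : eta * tau = c * (s2 - s1) / 2 by rewrite /eta; field; rewrite gt_eqF.
have key : rho tau <= - (l - l0) * (c * (s2 - s1) / 2).
  have : rho tau <= (l - l0) * (eta * tau - c * (s2 - s1)) by lra.
  by rewrite etaE; lra.
apply: (le_lt_trans key); rewrite mulNr oppr_lt0 mulr_gt0 ?subr_gt0//.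
by rewrite divr_gt0// mulr_gt0// subr_gt0.
Unshelve. all: by end_near. Qed.

Lemma ev_right_decreasing (tau l0 : R) j : 0 < tau <= t ->
  \forall l \near l0^'+, ev tau l j < ev tau l0 j.
Proof.
move=> taut; have /andP[tau0 taut'] := taut.
have st : 0 <= tau <= t by rewrite ltW.
apply: (near_eigenangle (p := fun=> tau) (q := id) (s0 := tau) (l0 := l0) (j := j) pa) => //.
- exact: cvg_cst.
- exact: cvg_within.
- exact: nearW.
move=> G y y0 PG FG yG y01 _ _.
have y0n : y0 != 0 by rewrite -dot_gt0 y01.
have := near_wronskian_neg taut PG FG yG y0n.
apply: filterS2 => l /= neg [pos small eqn].
rewrite -subr_lt0; apply: sin_lt0 => //.
by move: neg; rewrite eqn pmulr_llt0.
Qed.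

(** At tau = 0 the Wronskian is zero, so the eigenvalues are locally constant in
    lambda; this inequality is the part that bounds them for large lambda. *)
Lemma ev_init_right_noninc (l0 : R) j :
  \forall l \near l0^'+, ev 0 l j <= ev 0 l0 j.
Proof.
have st : (0 : R) <= 0 <= t by rewrite lexx ltW.
apply: (near_eigenangle (p := fun=> 0) (q := id) (s0 := 0) (l0 := l0) (j := j) pa) => //.
- exact: cvg_cst.
- exact: cvg_within.
- exact: nearW.
move=> G y y0 PG FG yG y01 _ _.
apply: filterS => l /= [pos small].
rewrite wronskian_init mulmx0 dot0l => /esym/eqP.
rewrite mulf_eq0 (gt_eqF pos) orbF => /eqP s0.
by rewrite -subr_le0; apply: sin_le0 => //; rewrite s0.
Qed.

Lemma ev_lambda_continuous tau j (A : set R) : 0 <= tau <= t ->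
  {within A, continuous (fun l => ev tau l j)}.
Proof.
move=> st; apply: continuous_subspaceT => l.
apply: (ev_cvg (p := fun=> tau) (q := id) pa) => //; first exact: cvg_cst.
exact: nearW.
Qed.

Lemma ev_decreasing (tau : R) j (l1 l2 : R) : 0 < tau <= t -> l1 < l2 ->
  ev tau l2 j < ev tau l1 j.
Proof.
move=> taut l12; have /andP[tau0 taut'] := taut.
have st : 0 <= tau <= t by rewrite ltW.
have h1 := ev_right_decreasing l1 j taut.
have h2 : \forall l \near l1^'+, l <= l2 by exact: nbhs_right_le.
have [l [le1 ll2]] := @filter_ex _ (l1^'+) _ _ (filterI h1 h2).
apply: le_lt_trans le1.
apply: (right_local_noninc (f := fun l => ev tau l j) ll2); first exact: ev_lambda_continuous.
by move=> x _; apply: filterS (ev_right_decreasing x j taut) => ? /ltW.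
Qed.

Lemma ev_init_noninc j (l1 l2 : R) : l1 <= l2 -> ev 0 l2 j <= ev 0 l1 j.
Proof.
move=> l12; apply: (right_local_noninc (f := fun l => ev 0 l j) l12).
  by apply: ev_lambda_continuous; rewrite lexx ltW.
by move=> x _; exact: ev_init_right_noninc.
Qed.

(** * Decay in tau and the limit at plus infinity *)

(** The form of the Hamiltonian, C[p] + (- D + lam E)[q], at the solution with
    q = - sin a v and q delta + p = cos a v, hence p = w. *)
Definition angle_rate (s lam a : R) (v : 'rV[R]_n) : R :=
  let w := cos a *: v + sin a *: (v *m delta) in
  dot (w *m C s) w + sin a ^+ 2 * dot (v *m (- D s + lam *: E s)) v.

(** The derivative at s0 of s |-> W(s0, s) is minus the Hamiltonian form, because
    W(s0, s0) = 0.  It bounds sin (ev s - ev s0) from above, and x <= sin x for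
    x <= 0. *)
Lemma ev_right_dini (lam s0 g : R) j : 0 <= s0 < t -> 0 <= g ->
  (forall v, v != 0 -> g * dot v v < angle_rate s0 lam (ev s0 lam j) v) ->
  \forall s \near s0^'+, ev s lam j <= ev s0 lam j - (s - s0) * g.
Proof.
move=> s0t g0 hg; have st : 0 <= s0 <= t by case/andP: s0t => -> /ltW.
have /andP[s00 s0lt] := s0t.
apply: (near_eigenangle (p := id) (q := fun=> lam) (s0 := s0) (l0 := lam) (j := j) pa) => //.
- exact: cvg_within.
- exact: cvg_cst.
- near=> s; apply/andP; split.
    by apply: (le_trans s00); near: s; exact: nbhs_right_ge.
  by near: s; exact: nbhs_right_le.
move=> G y y0 PG FG yG y01 [v0n yU yV] dG.
pose B s := wronskian (U s0 lam) (V s0 lam) (U s lam) (V s lam).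
pose M := - D s0 + lam *: E s0.
pose dB := U s0 lam *m (- (U s0 lam *m M))^T - V s0 lam *m (V s0 lam *m C s0)^T.
have hB : is_derive_within `[0, t] B s0 dB.
  have [dU dV] := hfr lam st.
  exact: (derive_withinB (derive_within_mulmxl (B := U s0 lam) (derive_within_trmx dV))
    (derive_within_mulmxl (B := V s0 lam) (derive_within_trmx dU))).
have B0 : B s0 = 0 by exact: wronskian_diag.
have BG : (s - s0)^-1 *: B s @[s --> G] --> dB.
  move=> A /hB HA; apply: FG.
  have : \forall s \near s0^'+, A ((s - s0)^-1 *: (B s - B s0)) by exact: near_right_itv s0t HA.
  by apply: filterS => s; rewrite B0 subr0.
pose v := y0 *m r s0 lam; pose a := ev s0 lam j.
have XG : (s - s0)^-1 * dot (y0 *m B s) (y s) @[s --> G] --> dot (y0 *m dB) y0.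
  have -> : (fun s => (s - s0)^-1 * dot (y0 *m B s) (y s)) =
      (fun s => dot (y0 *m ((s - s0)^-1 *: B s)) (y s)).
    by apply/funext => s; rewrite -scalemxAr dotZl.
  by apply: cvg_dot => //; apply: cvg_mulmx => //; exact: cvg_cst.
have dBE : dot (y0 *m dB) y0 = - angle_rate s0 lam a v.
  rewrite /dB mulmxBr dotBl linearN/= mulmxN mulmxN dotNl !mulmxA.
  rewrite (dot_mull _ _ (U s0 lam *m M)^T) (dot_mull _ _ (V s0 lam *m C s0)^T).
  rewrite !trmxK !mulmxA yU yV /angle_rate -/v -/a -/M.
  set w := cos a *: v + sin a *: (v *m delta).
  rewrite -scalemxAl dotZl dotZr (dotC v) (dotC w); ring.
have gt0G : \forall s \near G, s0 < s by apply: FG; exact: nbhs_right_gt.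
have neg : \forall s \near G, (s - s0)^-1 * dot (y0 *m B s) (y s)
     + g * dot v (y s *m r s lam) < 0.
  have XX : (s - s0)^-1 * dot (y0 *m B s) (y s) + g * dot v (y s *m r s lam)
      @[s --> G] --> dot (y0 *m dB) y0 + g * dot v v.
    by apply: cvgD => //; apply: cvgM => //; exact: cvg_cst.
  apply: (cvgr_lt _ XX).
  by rewrite dBE addrC subr_lt0 hg.
apply: filter_app; near=> s => /= -[pos small eqn].
have ss : s0 < s by near: s.
have : (s - s0)^-1 * dot (y0 *m B s) (y s) + g * dot v (y s *m r s lam) < 0 by near: s.
rewrite {1}/B eqn -/v -/a mulrA -mulrDl pmulr_llt0 // => h.
have h2 : sin (ev s lam j - a) < - (s - s0) * g.
  move: h; rewrite -ltrBrDr sub0r mulrC ltr_pdivrMr ?subr_gt0//.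
  by rewrite mulrC mulrN mulNr.
have ssg : 0 <= (s - s0) * g by rewrite mulr_ge0// subr_ge0 ltW.
have : ev s lam j - a <= sin (ev s lam j - a).
  by apply/le_sin_id/sin_le0 => //; apply: (le_trans (ltW h2)); rewrite mulNr oppr_le0.
by rewrite -/a; lra.
Unshelve. all: by end_near. Qed.

Lemma ev_tau_cvg lam j s : 0 <= s <= t ->
  (fun s => ev s lam j) @ within `[0, t] (nbhs s) --> ev s lam j.
Proof.
move=> st; apply: (ev_cvg (p := id) (q := fun=> lam) pa) => //.
- exact: cvg_within.
- exact: cvg_cst.
- by apply: filterS (withinT `[0, t] (nbhs_filter s)) => u; rewrite /= in_itv.
Qed.

(** By the previous bound and the chain rule, the modified angle of the eigenvalue
    decreases at least at the rate c sg; half of it leaves room for the error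
    terms of the one-sided estimates. *)
Lemma ev_tau_decay lam sg c j tau : 1 <= sg -> 0 < c -> 0 <= tau <= t ->
  (forall s a v, 0 <= s <= t -> v != 0 ->
     c * prufer_rate sg a * dot v v < angle_rate s lam a v) ->
  ev tau lam j <= ev 0 lam j + pi - c * sg / 2 * tau.
Proof.
move=> sg1 c0 /andP[tau0 taut] rate.
pose f s := ev s lam j.
pose G s := prufer sg (f s) + c * sg / 2 * s.
suff : G tau <= G 0.
  rewrite /G mulr0 addr0 => H.
  have := prufer_near sg (f tau); have := prufer_near sg (f 0).
  rewrite -/(f tau) -/(f 0); lra.
have cp : continuous (prufer sg).
  move=> z; apply/differentiable_continuous/derivable1_diffP.
  by apply: ex_derive; exact: is_derive_prufer.
apply: right_local_noninc => //.
  apply/subspace_continuousP => x; rewrite /= in_itv/= => /andP[x0 xtau].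
  have xt : 0 <= x <= t by rewrite x0 (le_trans xtau).
  apply: cvgD.
    apply: (@cvg_comp _ _ _ f (prufer sg) _ (nbhs (f x))); last exact: cp.
    have := ev_tau_cvg (lam := lam) (j := j) xt.
    apply: cvg_trans; apply: cvg_app; apply: within_subset.
    by move=> u /=; rewrite !in_itv/=; lra.
  by apply: cvgM; [exact: cvg_cst|exact: cvg_within].
move=> x /andP[x0 xtau].
have xt : 0 <= x < t by rewrite x0 (lt_le_trans xtau).
have xt' : 0 <= x <= t by rewrite x0 ltW// (lt_le_trans xtau).
pose a := f x; have Q0 := prufer_rate_gt0 sg1 a.
pose g := c * prufer_rate sg a.
have g0 : 0 < g by rewrite mulr_gt0.
have dini := ev_right_dini xt (ltW g0) (fun v => rate x a v xt').
have dp := is_derive_prufer sg1 a.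
have hq : - g * (s - x) @[s --> x^'+] --> 0^'.
  move=> A /= [e /= e0 he].
  suff : \forall s \near x^'+, A (- g * (s - x)) by [].
  near=> s; apply: he => /=; last first.
    rewrite mulf_neq0// ?oppr_eq0 ?gt_eqF// subr_gt0.
    by near: s; exact: nbhs_right_gt.
  rewrite sub0r normrN normrM normrN (gtr0_norm g0) mulrC -ltr_pdivlMr//.
  rewrite ger0_norm ?subr_ge0; last by near: s; exact: nbhs_right_ge.
  rewrite ltrBlDl; near: s; apply: nbhs_right_lt.
  by rewrite ltrDl divr_gt0.
have dq : (fun h => h^-1 *: (prufer sg (h *: 1 + a) - prufer sg a)) @ 0^' --> sg / prufer_rate sg a.
  by have [ex <-] := dp; exact: ex.
have quot := cvg_comp _ _ hq dq.
have half : sg / prufer_rate sg a / 2 < sg / prufer_rate sg a.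
  have : 0 < sg / prufer_rate sg a by rewrite divr_gt0// (lt_le_trans ltr01).
  by lra.
have hq2 : \forall s \near x^'+, sg / prufer_rate sg a / 2 <
    (- g * (s - x))^-1 * (prufer sg ((- g * (s - x)) * 1 + a) - prufer sg a).
  exact: (cvgr_gt _ quot _ half).
have gtx : \forall s \near x^'+, x < s by exact: nbhs_right_gt.
apply: filterS3 dini hq2 gtx => s fs qs xs.
have gs : 0 < g * (s - x) by rewrite mulr_gt0// subr_gt0.
rewrite /G; apply: (@le_trans _ _ (prufer sg (- g * (s - x) * 1 + a) + c * sg / 2 * s)).
  by rewrite lerD2r prufer_le// mulr1 /a /f mulNr [g * _]mulrC addrC.
have hQ : g * (sg / prufer_rate sg a / 2) = c * sg / 2.
  by rewrite /g; field; rewrite gt_eqF.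
move: qs; rewrite mulNr invrN mulNr -/(f x) -/a.
set d := prufer sg _ - prufer sg a => qs.
have : d < - (c * sg / 2 * (s - x)).
  rewrite -hQ ltrNr mulrAC -ltr_pdivlMl//.
  by rewrite mulrN -mulNr.
by rewrite /d /=; lra.
Unshelve. all: by end_near. Qed.

(** For w = cos a v + sin a (v delta), |w|^2 >= cos^2 a |v|^2 / 2 - sin^2 a |v delta|^2.
    The last term is absorbed by the term lam sin^2 a E[v] when lam is large. *)
Lemma angle_rate_lower : exists2 c, 0 < c & forall sg, exists L : R,
  forall lam s a v, L <= lam -> 0 <= s <= t -> v != 0 -> 1 <= sg ->
    c * prufer_rate sg a * dot v v < angle_rate s lam a v.
Proof.
have [c1 [hc1 /(_ posC) c10]] := form_min cC.
have [e [he /(_ posE) e0]] := form_min cE.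
have cND : {within `[0, t], continuous (fun s => - D s)}.
  by move=> s; apply: cvgN; exact: cD.
have [d [hd _]] := form_min cND.
have [k [hk _]] := @form_min R n t (fun=> - (delta *m delta^T))
  (continuous_subspaceT (fun _ => cvg_cst _)).
exists (c1 / 4); first by rewrite divr_gt0.
move=> sg; exists (Num.max 0 ((c1 * - k + c1 / 2 * sg ^+ 2 - d) / e)).
move=> lam s a v; rewrite ge_max ler_pdivrMr// => /andP[lam0 lamL] st v0 sg1.
have vv : 0 < dot v v by rewrite dot_gt0.
rewrite /angle_rate /=; set w := cos a *: v + _; set M := - D s + lam *: E s.
have hM : (c1 * - k + c1 / 2 * sg ^+ 2) * dot v v <= dot (v *m M) v.
  rewrite /M mulmxDr dotDl -scalemxAr dotZl.
  have h1 := hd s v st; have h2 := ler_wpM2l lam0 (he s v st).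
  apply: le_trans (lerD h1 h2).
  have -> : d * dot v v + lam * (e * dot v v) = (d + lam * e) * dot v v by ring.
  by rewrite ler_pM2r//; lra.
have hw : dot w w >= cos a ^+ 2 * dot v v / 2 - sin a ^+ 2 * dot (v *m delta) (v *m delta).
  (* |A + B|^2 - |A|^2 / 2 + |B|^2 = |A + 2 B|^2 / 2 *)
  have := dot_ge0 (cos a *: v + 2 *: (sin a *: (v *m delta))).
  rewrite /w !dotDl !dotDr !dotZl !dotZr (dotC (v *m delta) v); lra.
have hdl : dot (v *m delta) (v *m delta) <= - k * dot v v.
  have /(hk 0 v) : (0 : R) <= 0 <= t by rewrite lexx ltW.
  by rewrite mulmxN dotNl mulmxA (dot_mull (v *m delta) v) trmxK; lra.
have hC := hc1 s w st.
have sa := sqr_ge0 (sin a); have ca := sqr_ge0 (cos a).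
have Q0 := prufer_rate_gt0 sg1 a.
apply: (@lt_le_trans _ _ (c1 / 2 * prufer_rate sg a * dot v v)).
  rewrite ltr_pM2r// ltr_pM2r//; lra.
have h1 := ler_wpM2l sa hM; have h2 := ler_wpM2l (ltW c10) hw.
have h3 := ler_wpM2l sa hdl; have h4 := ler_wpM2l (ltW c10) h3.
rewrite /prufer_rate; lra.
Qed.

Lemma ev_cvg_ninfty tau j : 0 < tau <= t ->
  ev tau lam j @[lam --> +oo] --> -oo.
Proof.
move=> /andP[tau0 taut]; have [c c0 rate] := angle_rate_lower.
apply/cvgrNyPle => A.
pose sg := 1 + `|ev 0 0 j + pi - A| / (c / 2 * tau).
have ct : 0 < c / 2 * tau by rewrite mulr_gt0 ?divr_gt0.
have sg1 : 1 <= sg by rewrite lerDl divr_ge0 ?(ltW ct).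
have [L hL] := rate sg.
have init lam : 0 <= lam -> ev 0 lam j <= ev 0 0 j.
  by move=> lam0; exact: ev_init_noninc.
near=> lam.
have lam0 : 0 <= lam by near: lam; exact: nbhs_pinfty_ge.
have lamL : L <= lam by near: lam; exact: nbhs_pinfty_ge (num_real L).
have taut' : 0 <= tau <= t by rewrite (ltW tau0) taut.
have := @ev_tau_decay lam sg c j tau sg1 c0 taut'
  (fun s a v st v0 => hL lam s a v lamL st v0 sg1).
have := init lam lam0.
have -> : c * sg / 2 * tau = c / 2 * tau + `|ev 0 0 j + pi - A|.
  by rewrite /sg; field; rewrite !gt_eqF.
have := ler_norm (ev 0 0 j + pi - A); lra.
Unshelve. all: by end_near. Qed.

(** * The limit at minus infinity *)

(** At 0 the form is - y alpha beta^T y^T.  Since alpha beta^T is symmetric, it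
    factors as alpha X alpha^T even if alpha is singular, so it is controlled
    by |y alpha|^2. *)
Lemma init_lower : exists k, forall (lam : R) (y : 'rV[R]_n),
  k * dot (y *m U 0 lam) (y *m U 0 lam) <= dot (y *m U 0 lam) (y *m V 0 lam).
Proof.
pose X := pinvmx alpha *m beta.
have XE : alpha *m beta^T = alpha *m X *m alpha^T.
  by rewrite -2!mulmxA -hab 2![in RHS]mulmxA mulmxKpV.
exists (- (`|X| * n%:R)) => lam y; rewrite hU0 hV0 mulmxN dotNr.
have -> : dot (y *m alpha) (y *m beta) = dot (y *m alpha *m X) (y *m alpha).
  rewrite -[in LHS](trmxK beta) -dot_mull -mulmxA XE.
  by move: X {XE} => X; rewrite !mulmxA (dot_mull _ _ alpha^T) trmxK.
rewrite mulNr lerN2.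
exact: le_trans (ler_norm _) (dot_mul_le_norm _ _).
Qed.

(** The function H = kap |q|^2 - <q, p>, with kap affine, is at most 0 at 0 and
    is nonincreasing when - lam is large: completing the square,
    H' = kap' |q|^2 + kap^2 C[q] - C[p - kap q] + (- D + lam E)[q].
    The slope of kap is chosen so that kap >= k1 from tau on. *)
Lemma riccati_lower (k1 tau : R) : 0 < tau -> exists L : R, forall lam s y,
  lam <= L -> tau <= s <= t ->
  k1 * dot (y *m U s lam) (y *m U s lam) <= dot (y *m U s lam) (y *m V s lam).
Proof.
move=> tau0; have [k0 hk0] := init_lower.
have [e [he /(_ posE) e0]] := form_min cE.
have [d [hd _]] := form_min cD.
have cNC : {within `[0, t], continuous (fun s => - C s)}.
  by move=> s; apply: cvgN; exact: cC.
have [c' [hc' _]] := form_min cNC.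
pose l := (`|k1| + `|k0|) / tau.
have l0 : 0 <= l by rewrite divr_ge0 ?addr_ge0// ltW.
have ltau : l * tau = `|k1| + `|k0| by rewrite /l divfK// gt_eqF.
pose B := `|k0| + l * t.
exists (Num.min 0 ((d - l - B ^+ 2 * `|c'|) / e)).
move=> lam s y; rewrite le_min ler_pdivlMr// => /andP[lam0 lamL] /andP[taus st].
pose x u := y *m U u lam; pose p u := y *m V u lam.
pose kap u := k0 + l * u.
pose H u := kap u * dot (x u) (x u) - dot (x u) (p u).
pose M u := - D u + lam *: E u.
pose dH u := l * dot (x u) (x u) + kap u * (2 * dot (p u *m C u) (x u))
  - (dot (p u *m C u) (p u) - dot (x u *m M u) (x u)).
have s0 : 0 <= s by lra.
have ut u : 0 <= u <= s -> 0 <= u <= t by lra.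
have hH u : 0 <= u <= s -> is_sderive_within `[0, t] H u (dH u).
  move=> /ut us; have [dU dV] := hfr lam us.
  have dxp := sderive_within_dot (y := y) (z := y)
    (derive_within_mulmx dU (derive_within_trmx dV)).
  have dxx := sderive_within_dot (y := y) (z := y)
    (derive_within_mulmx dU (derive_within_trmx dU)).
  have dk : is_sderive_within `[0, t] kap u l by exact: sderive_within_affine.
  have := sderive_withinB (sderive_withinM dk dxx) dxp.
  have mulE (X Y : 'M[R]_n) : dot (y *m (X *m Y^T)) y = dot (y *m X) (y *m Y).
    by rewrite mulmxA dot_mull trmxK.
  have -> : (fun v => kap v * dot (y *m (U v lam *m (U v lam)^T)) y
      - dot (y *m (U v lam *m (V v lam)^T)) y) = H.
    by apply/funext => v; rewrite !mulE.
  congr (is_sderive_within _ _ _ _); rewrite /dH -/(M u); move: (M u) => Mu.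
  rewrite !mulmxDr !dotDl !mulE mulmxN dotNr !mulmxA -/(x u) -/(p u).
  by rewrite (dotC (x u) (p u *m C u)) (dotC (x u) (x u *m Mu)); ring.
have dH0 u : 0 <= u <= s -> dH u <= 0.
  move=> us; have ut' := ut u us; have xx := dot_ge0 (x u).
  have kB' : `|kap u| <= B.
    rewrite (le_trans (ler_normD _ _))// lerD2l normrM (ger0_norm l0) ler_wpM2l//.
    by rewrite ger0_norm; lra.
  have kB : kap u ^+ 2 <= B ^+ 2.
    rewrite -[leLHS]real_normK ?num_real// ler_pXn2r ?nnegrE//.
    exact: le_trans kB'.
  have hM : (d - lam * e) * dot (x u) (x u) <= - dot (x u *m M u) (x u).
    rewrite /M mulmxDr dotDl mulmxN dotNl -scalemxAr dotZl.
    have h1 := hd u (x u) ut'; have h2 := ler_wnM2l lam0 (he u (x u) ut').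
    by lra.
  have hC : 0 <= dot ((p u - kap u *: x u) *m C u) (p u - kap u *: x u).
    have [->|z] := eqVneq (p u - kap u *: x u) 0; first by rewrite mul0mx dot0l.
    by rewrite ltW//; exact: (posC ut').2.
  have symx : dot (x u *m C u) (p u) = dot (p u *m C u) (x u).
    by rewrite dot_mull (posC ut').1 dotC.
  have hc : dot (x u *m C u) (x u) <= `|c'| * dot (x u) (x u).
    have := hc' u (x u) ut'; rewrite mulmxN dotNl => h.
    have := ler_wpM2r xx (ler_norm (- c')); rewrite normrN; lra.
  have hk : kap u ^+ 2 * dot (x u *m C u) (x u) <= B ^+ 2 * `|c'| * dot (x u) (x u).
    apply: (le_trans (ler_wpM2l (sqr_ge0 _) hc)).
    rewrite mulrA ler_wpM2r//; exact: (ler_wpM2r (normr_ge0 c') kB).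
  have hl := ler_wpM2r xx lamL.
  move: hC; rewrite mulmxBl -scalemxAl !dotBl !dotBr !dotZl !dotZr symx /dH; lra.
have Hs : H s <= H 0 by exact: (sderive_within_noninc (lexx 0) s0 st hH dH0).
have H0 : H 0 <= 0 by rewrite /H /kap mulr0 addr0 subr_le0; exact: hk0.
have : kap s * dot (x s) (x s) <= dot (x s) (p s).
  by rewrite -subr_le0; exact: le_trans H0.
apply: le_trans; rewrite ler_wpM2r ?dot_ge0// /kap.
have : l * tau <= l * s by rewrite ler_wpM2l.
have := ler_norm k1; have := ler_norm (- k0); rewrite normrN; lra.
Qed.

(** For q = - sin a v and p = cos a v + sin a (v delta), the inequality
    <q, p> >= k |q|^2 reads - sin a cos a >= (k - |delta|) sin^2 a, up to
    the constant in front of |delta|. *)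
Lemma sin_small (k1 tau : R) : 0 < tau -> exists L : R, forall lam s j,
  lam <= L -> tau <= s <= t ->
  k1 * `|sin (ev s lam j)| <= `|cos (ev s lam j)|.
Proof.
move=> tau0; have [L hL] := riccati_lower (k1 + `|delta| * n%:R) tau0.
exists L => lam s j lamL st; have ss : 0 <= s <= t by lra.
have [y [_ _ [v0 yU yV]]] := eigenangle_unit pa lam j ss.
have := hL lam s y lamL st; rewrite yU yV.
set v := y *m r s lam in v0 *; set a := ev s lam j.
have vv : 0 < dot v v by rewrite dot_gt0.
rewrite !dotDr !dotZl !dotZr.
have hd : - (`|delta| * n%:R * dot v v) <= dot v (v *m delta).
  rewrite dotC; have := dot_mul_le_norm v delta; rewrite ler_norml; lra.
have hs := ler_wpM2l (sqr_ge0 (sin a)) hd.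
move=> h.
have {h}h : k1 * sin a ^+ 2 * dot v v <= - (sin a * cos a) * dot v v by lra.
rewrite ler_pM2r// in h.
have [s0|s0] := eqVneq (sin a) 0; first by rewrite s0 normr0 mulr0.
have sa : 0 < `|sin a| by rewrite normr_gt0.
rewrite -(ler_pM2r sa) -mulrA -expr2 real_normK ?num_real// -normrM.
by apply: (le_trans h); rewrite (le_trans (ler_norm _))// normrN mulrC.
Qed.

Lemma near_cos_unitmx tau : 0 < tau <= t ->
  \forall lam \near -oo, symfun cos (phi tau lam) \in unitmx.
Proof.
move=> /andP[tau0 taut]; have [L hL] := sin_small 1 tau0.
near=> lam; have lamL : lam <= L by near: lam; exact: nbhs_ninfty_le (num_real L).
have st : 0 <= tau <= t by lra.
have [P hP] := polar_diag pa lam st.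
have [PP ->] := symfun_diagonalizes cos hP.
rewrite unitmxE unitfE !det_mulmx mulrAC -det_mulmx PP det1 mul1r det_diag.
apply/prodf_neq0 => i _; rewrite mxE; apply: cos_neq0_of_le.
by have := hL lam tau i lamL; rewrite mul1r; apply; lra.
Unshelve. all: by end_near. Qed.

Lemma tan_cvg0 tau : 0 < tau <= t ->
  symfun tan (phi tau lam) @[lam --> -oo] --> (0 : 'M[R]_n).
Proof.
move=> /andP[tau0 taut]; apply/cvg_mxP => i k; rewrite mxE.
apply/cvgr0Pnorm_le => eps eps0.
pose k1 := n.+1%:R / Num.min eps 1.
have m0 : 0 < Num.min eps 1 by rewrite lt_min eps0 ltr01.
have k10 : 0 < k1 by rewrite divr_gt0.
have k11 : 1 <= k1.
  by rewrite /k1 ler_pdivlMr// mul1r ge_min ler1n orbT.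
have [L hL] := sin_small k1 tau0.
near=> lam; have lamL : lam <= L by near: lam; exact: nbhs_ninfty_le (num_real L).
have st : 0 <= tau <= t by lra.
have [P hP] := polar_diag pa lam st.
have tanb l : `|tan (ev tau lam l)| <= k1^-1.
  have h : k1 * `|sin (ev tau lam l)| <= `|cos (ev tau lam l)|.
    by apply: hL => //; rewrite lexx.
  have c0 : cos (ev tau lam l) != 0.
    by apply: cos_neq0_of_le; apply: le_trans h; rewrite ler_peMl.
  rewrite /tan normrM normfV ler_pdivrMr ?normr_gt0//.
  by rewrite ler_pdivlMl.
have Pb a b : `|P a b| <= 1.
  rewrite -(@ler_pXn2r _ 2)// ?nnegrE// expr1n real_normK ?num_real//.
  have PPa : dot (row a P) (row a P) = 1.
    have := congr1 (fun M : 'M[R]_n => M a a) hP.1; rewrite [RHS]mxE eqxx mulr1n => <-.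
    by rewrite dotE [RHS]mxE; apply: eq_bigr => c _; rewrite !mxE.
  by rewrite -PPa; have := sqr_coord_le_dot (row a P) b; rewrite mxE.
have [_ ->] := symfun_diagonalizes tan hP.
rewrite mxE (le_trans (ler_norm_sum _ _ _))//.
apply: (@le_trans _ _ (\sum_(l < n) k1^-1)).
  apply: ler_sum => l _; rewrite mul_mx_diag !mxE /= 2!normrM.
  rewrite -[leRHS]mulr1 -[k1^-1]mul1r.
  apply: ler_pM => //.
  by apply: ler_pM => //; exact: tanb.
rewrite sumr_const card_ord /k1 invf_div -[leLHS]mulr_natr.
rewrite mulrAC ler_pdivrMr//; apply: ler_pM => //.
- exact: ltW.
- by rewrite ge_min lexx.
- by rewrite ler_nat.
Unshelve. all: by end_near. Qed.

(** The zero c of the sine is determined at tau = t.  The path that leads from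
    (t, L1) to (t, lam) and then to (tau, lam) stays where the cosine does not
    vanish, so the eigenvalue at (tau, lam) is within pi / 2 of the same c. *)
Lemma ev_cvg_const j : exists c : R, forall tau, 0 < tau <= t ->
  ev tau lam j @[lam --> -oo] --> c.
Proof.
have [L1 hL1] := sin_small 1 t0.
pose f := ev t L1 j.
have tt : t <= t <= t by rewrite lexx.
have cos_t lam : lam <= L1 -> cos (ev t lam j) != 0.
  by move=> lamL; apply: cos_neq0_of_le; have := hL1 lam t j lamL tt; rewrite mul1r.
have cf := cos_t L1 (lexx _).
pose c := f - atan (tan f).
have ca : cos (atan (tan f)) != 0.
  by rewrite gt_eqF// cos_gt0_pihalf// atan_gtNpi2 atan_ltpi2.
have sc : sin c = 0.
  rewrite /c sinB.
  have -> : sin (atan (tan f)) = tan f * cos (atan (tan f)).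
    by rewrite -{2}[tan f]atanK {1}/tan divfK.
  by rewrite /tan mulrA [cos f * _]mulrC divfK// subrr.
have fc : `|f - c| < pi / 2.
  by rewrite /c opprB addrC subrK ltr_norml atan_gtNpi2 atan_ltpi2.
exists c => tau /andP[tau0 taut]; apply/cvgrPdist_le => eps eps0.
have p0 := pi_gt0 R.
pose e := Num.min eps (pi / 4).
have e0 : 0 < e by rewrite lt_min eps0 divr_gt0.
have ep : e < pi by rewrite gt_min; apply/orP; right; lra.
have se : 0 < sin e by apply: sin_gt0_pi; rewrite e0.
have [L2 hL2] := sin_small (1 + 2 / sin e) tau0.
near=> lam.
have lamL2 : lam <= L2 by near: lam; exact: nbhs_ninfty_le (num_real L2).
have lamL1 : lam <= L1 by near: lam; exact: nbhs_ninfty_le (num_real L1).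
have k0 : 0 < 2 / sin e by rewrite divr_gt0.
have cos_s s : tau <= s <= t -> cos (ev s lam j) != 0.
  move=> st; apply: cos_neq0_of_le; apply: le_trans (hL2 lam s j lamL2 st).
  by rewrite ler_peMl// lerDl ltW.
have ss : 0 <= t <= t by rewrite lexx ltW.
have bt : `|ev t lam j - c| < pi / 2.
  apply: (@IVT_branch R (fun l => ev t l j) lam L1 c lamL1) => //.
    exact: ev_lambda_continuous.
  by move=> x /andP[_]; exact: cos_t.
have bs : `|ev tau lam j - c| < pi / 2.
  apply: (@IVT_branch R (fun s => ev s lam j) tau t c taut) => //.
  apply/subspace_continuousP => x; rewrite /= in_itv/= => /andP[x0 xtau].
  have xt : 0 <= x <= t by lra.
  have := ev_tau_cvg (lam := lam) (j := j) xt.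
  apply: cvg_trans; apply: cvg_app; apply: within_subset.
  by move=> u /=; rewrite !in_itv/=; lra.
rewrite distrC leNgt; apply/negP => far.
have ex : e <= `|ev tau lam j - c| by rewrite ge_min (ltW far).
have h1 := sin_norm_mono e0 ex bs.
have h2 : (1 + 2 / sin e) * `|sin (ev tau lam j)| <= `|cos (ev tau lam j)|.
  by apply: hL2 => //; rewrite lexx.
rewrite (norm_sin_shift _ sc) in h2.
have h3 := le_trans h2 (cos_max _).
have : 2 <= 2 / sin e * `|sin (ev tau lam j - c)|.
  by rewrite mulrAC ler_pdivlMr// ler_wpM2l.
have := normr_ge0 (sin (ev tau lam j - c)); lra.
Unshelve. all: by end_near. Qed.

End BoundaryProblem.

(** * Diagonalizability of the angle and conclusion *)

Lemma symfun_not_diag (R : realType) n (f : R -> R) (A : 'M[R]_n) :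
  ~ (exists P d, diagonalizes P A d) -> symfun f A = 0.
Proof.
move=> nA; apply: xgetPN => B [P [d [PP AE _]]]; apply: nA.
exists P, (fun i => d ord0 i); split=> //.
by rewrite AE; congr (_ *m diag_mx _ *m _); apply/rowP => i; rewrite mxE.
Qed.

(** If A were not diagonalizable, then sin A and cos A would both be 0, and so
    would U s and V s.  But their Wronskian with a complementary solution is
    constant, equal to the identity. *)
Lemma frame_diagonalizable (R : realType) n (t lam s : R) (C D E : R -> 'M[R]_n)
    (U V U' V' : R -> 'M[R]_n) (delta r A : 'M[R]_n) :
  (forall s : R, 0 <= s <= t -> (C s)^T = C s) ->
  (forall s : R, 0 <= s <= t -> (D s)^T = D s) ->
  (forall s : R, 0 <= s <= t -> (E s)^T = E s) ->
  frame t C D E lam U V -> frame t C D E lam U' V' ->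
  wronskian (U 0) (V 0) (U' 0) (V' 0) = 1%:M ->
  0 <= s <= t -> - U s = r *m symfun sin A ->
  U s *m delta + V s = r *m symfun cos A -> exists P d, diagonalizes P A d.
Proof.
move=> sC sD sE h h' W1 st Us Vs; apply: contrapT => nA.
have U0 : U s = 0.
  by apply/eqP; rewrite -oppr_eq0 Us symfun_not_diag// mulmx0.
have V0 : V s = 0.
  by rewrite -[V s]add0r -{1}(mul0mx _ delta) -U0 Vs symfun_not_diag// mulmx0.
have := wronskian_const sC sD sE h h' st.
rewrite W1 /wronskian U0 V0 !mul0mx subrr => one0.
apply: nA; exists 1%:M, (fun=> 0).
have A0 (B : 'M[R]_n) : B = 0 by rewrite -[B]mulmx1 -one0 mulmx0.
by split; rewrite [LHS]A0 [RHS]A0.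
Qed.

Theorem theorem5p5 (R : realType) (n : nat) (t : R) (C0 D E : R -> 'M[R]_n)
    (Qc Pc Qs Ps : R -> R -> 'M[R]_n)
    (alpha0 beta0 delta : 'M[R]_n)
    (r phi : R -> R -> 'M[R]_n) (ev : R -> R -> 'I_n -> R) :
  0 < t ->
  {within `[0, t], continuous C0} ->
  {within `[0, t], continuous D} ->
  {within `[0, t], continuous E} ->
  (forall tau : R, 0 <= tau <= t -> posdefmx (C0 tau)) ->
  (forall tau : R, 0 <= tau <= t -> (D tau)^T = D tau) ->
  (forall tau : R, 0 <= tau <= t -> posdefmx (E tau)) ->
  (forall lam : R, hamiltonian_solution t C0 D E lam
     (fun tau => Qc tau lam) (fun tau => Pc tau lam)) ->
  (forall lam : R, hamiltonian_solution t C0 D E lam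
     (fun tau => Qs tau lam) (fun tau => Ps tau lam)) ->
  (forall lam : R, [/\ Qc 0 lam = 1%:M, Pc 0 lam = 0,
                       Qs 0 lam = 0 & Ps 0 lam = 1%:M]) ->
  alpha0 *m beta0^T = beta0 *m alpha0^T ->
  alpha0 *m alpha0^T + beta0 *m beta0^T = 1%:M ->
  delta^T = delta ->
  {within `[0, t] `*` [set: R], continuous (fun z : R * R => r z.1 z.2)} ->
  {within `[0, t] `*` [set: R], continuous (fun z : R * R => phi z.1 z.2)} ->
  (forall tau lam : R, 0 <= tau <= t -> \det (r tau lam) != 0) ->
  (forall tau lam : R, 0 <= tau <= t -> (phi tau lam)^T = phi tau lam) ->
  (forall tau lam : R, 0 <= tau <= t ->
     bdQ1 alpha0 beta0 (Qc tau lam) (Qs tau lam)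
       = r tau lam *m symfun sin (phi tau lam)) ->
  (forall tau lam : R, 0 <= tau <= t ->
     bdQ2 alpha0 beta0 delta (Qc tau lam) (Pc tau lam) (Qs tau lam) (Ps tau lam)
       = r tau lam *m symfun cos (phi tau lam)) ->
  (forall tau lam : R, 0 <= tau <= t ->
     ordered_eigenvalues (phi tau lam) (ev tau lam)) ->
  (forall tau : R, 0 < tau <= t ->
     [/\ forall j : 'I_n, ev tau lam j @[lam --> +oo] --> -oo,
         \forall lam \near -oo, symfun cos (phi tau lam) \in unitmx,
         symfun tan (phi tau lam) @[lam --> -oo] --> (0 : 'M[R]_n) &
         forall (j : 'I_n) (lam1 lam2 : R), lam1 < lam2 ->
           ev tau lam2 j < ev tau lam1 j]) /\
  (forall j : 'I_n, exists c : R, forall tau : R, 0 < tau <= t ->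
     ev tau lam j @[lam --> -oo] --> c).
Proof.
move=> t0 cC cD cE posC symD posE hc hs init hab hnd symd cr cphi detr symphi hQ1 hQ2 hev.
pose U s lam := alpha0 *m (Qc s lam)^T - beta0 *m (Qs s lam)^T.
pose V s lam := alpha0 *m (Pc s lam)^T - beta0 *m (Ps s lam)^T.
have symC s : 0 <= s <= t -> (C0 s)^T = C0 s by move=> /posC[].
have symE s : 0 <= s <= t -> (E s)^T = E s by move=> /posE[].
have hfr lam : frame t C0 D E lam (U^~ lam) (V^~ lam).
  exact: frame_of_solutions (hc lam) (hs lam).
have hU0 lam : U 0 lam = alpha0.
  by rewrite /U; have [-> _ -> _] := init lam; rewrite trmx1 trmx0 mulmx1 mulmx0 subr0.
have hV0 lam : V 0 lam = - beta0.
  by rewrite /V; have [_ -> _ ->] := init lam; rewrite trmx1 trmx0 mulmx1 mulmx0 sub0r.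
have sinU s lam : 0 <= s <= t -> - U s lam = r s lam *m symfun sin (phi s lam).
  by move=> st; rewrite -hQ1// /bdQ1 /U opprB addrC.
have cosV s lam : 0 <= s <= t ->
    U s lam *m delta + V s lam = r s lam *m symfun cos (phi s lam).
  by move=> st; rewrite -hQ2// /bdQ2 /U /V addrA.
have pa : polar_angle t delta U V r phi ev.
  split=> // s lam st; last by case: (hev s lam st).
  (* initial data (beta0, alpha0), complementary to (alpha0, - beta0) *)
  have hfr' := frame_of_solutions symC symD symE beta0 (- alpha0) (hc lam) (hs lam).
  have [|P [d hP]] := frame_diagonalizable symC symD symE (hfr lam) hfr' _ st (sinU s lam st) (cosV s lam st).
    rewrite /wronskian hU0 hV0; have [-> -> -> ->] := init lam.
    by rewrite !trmx1 !trmx0 !mulmx1 !mulmx0 !mulNmx subr0 sub0r !opprK.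
  exact: ordered_diagonalizes hP (hev s lam st).
split; last by move=> j; exact: (ev_cvg_const t0 pa cC cD cE posC posE hfr hU0 hV0 hab).
move=> tau taut; split.
- by move=> j; exact: (ev_cvg_ninfty t0 pa cC cD cE posC symD posE hfr hU0 hV0 hab).
- exact: (near_cos_unitmx pa cC cD cE posC posE hfr hU0 hV0 hab taut).
- exact: (tan_cvg0 pa cC cD cE posC posE hfr hU0 hV0 hab taut).
- by move=> j l1 l2 l12; exact: (ev_decreasing t0 pa cE posC symD posE hfr hU0 hV0 hab hnd).
Qed.
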